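(* There exist constants $C_1,C_2>0$ such that the following holds for every non-dyadic $x\in(0,1)$. Let $h$ be the harmonic function on $\Omega_x$ with boundary values $h(q_0)=a$ and $h|_{S(x)}=f$, where $$f=b+\sum_{\omega}c_\omega\psi_\omega,\qquad c_\omega=\int_{S(x)}f\,\psi_\omega\,d\mu .$$ Put $$Q=\left(\tfrac{5}{3}\right)^{n_1}(a-b)^2+\sum_{m=0}^{\infty}\sum_{|\omega|=m}2^m\left(\tfrac{5}{3}\right)^{n_{m+1}}|c_\omega|^2 .$$ Then $C_1 Q\le \mathcal{E}(h)\le C_2 Q$. In particular, $h$ has finite energy if and only if $Q<\infty$.
   Context: Let $q_0,q_1,q_2$ be the vertices of an equilateral triangle of height $1$ in the plane, $q_0$ on top and $q_1q_2$ horizontal; $F_i(p)=(p+q_i)/2$; $\mathcal{SG}$ is the Sierpinski gasket, i.e. the attractor of $F_0,F_1,F_2$. Products and powers of the $F_i$ are compositions. An $n$-cell is a set $F_{i_1}\cdots F_{i_n}(\mathcal{SG})$; its vertices are the images of $q_0,q_1,q_2$. Let $x\in(0,1)$ be not a dyadic rational, written uniquely as $x=\sum_{k\ge1}2^{-n_k}$ with integers $0<n_1<n_2<\cdots$ (infinite sequence); put $n_0=0$. Let $L_x$ be the horizontal line at distance $x$ below $q_0$, $\Omega_x$ the set of points of $\mathcal{SG}$ strictly above $L_x$, and $S(x)=\mathcal{SG}\cap L_x$ (a Cantor set). The boundary of $\Omega_x$ is $\{q_0\}\cup S(x)$. A function on $\Omega_x$ is harmonic if $\Delta h=0$ on $\Omega_x\setminus\{q_0\}$,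 $\Delta$ the standard Kigami Laplacian. For a word $\omega=(\omega_1,\dots,\omega_m)$ with $\omega_j\in\{1,2\}$, $|\omega|=m\ge 0$, put $\tilde F_\omega=F_0^{n_1-1}F_{\omega_1}F_0^{n_2-n_1-1}F_{\omega_2}\cdots F_0^{n_m-n_{m-1}-1}F_{\omega_m}$ ($\tilde F_\emptyset=\mathrm{id}$) and $S_\omega(x)=S(x)\cap\tilde F_\omega(\mathcal{SG})$. The Cantor measure $\mu$ is the probability measure on $S(x)$ with $\mu(S_\omega(x))=2^{-|\omega|}$. The Haar function $\psi_\omega$ is supported on $S_\omega(x)$, equals $2^{m/2}$ on $S_{\omega1}(x)$ and $-2^{m/2}$ on $S_{\omega2}(x)$, $m=|\omega|$; $\{1\}\cup\{\psi_\omega\}$ is an orthonormal basis of $L^2(S(x),\mu)$. $h_0$ is the harmonic function, continuous on $\Omega_x\cup S(x)$, with $h_0(q_0)=1$, $h_0|_{S(x)}=0$; $h_\omega$ is the one with $h_\omega(q_0)=0$, $h_\omega|_{S(x)}=\psi_\omega$. The harmonic function with boundary values $a$ at $q_0$ and $f=b+\sum_\omega c_\omega\psi_\omega$ on $S(x)$ is $h=a h_0+b(1-h_0)+\sum_{m\ge0}\sum_{|\omega|=m}c_\omega h_\omega$ (at each point of $\Omega_x$ only finitely many terms are nonzero). Energy on $\Omega_x$: $\mathcal{E}(u)=\lim_{m\to\infty}\left(\frac53\right)^{n_m}\sum_{C}\sum_{\{p,q\}}(u(p)-u(q))^2\in[0,\infty]$, where $C$ runs over the $n_m$-cells contained in $\Omega_x$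 and $\{p,q\}$ over the three pairs of distinct vertices of $C$ (a nondecreasing sequence). *)

(* Defs.v *)
From HB Require Import structures.
From mathcomp Require Import all_boot all_order all_algebra.
From mathcomp Require Import all_classical all_reals all_analysis.
From mathcomp Require Import ring lra.
Import Order.TTheory GRing.Theory Num.Theory.
Import numFieldNormedType.Exports.

Set Implicit Arguments.
Unset Strict Implicit.
Unset Printing Implicit Defensive.

Local Open Scope classical_set_scope.
Local Open Scope ring_scope.

(* Coordinates are chosen so that the side [q1 q2] lies on the axis y = 0. *)
Definition qv {R : realType} (i : 'I_3) : R * R :=
  if i == 0%N :> nat then (0, 1)
  else if i == 1%N :> nat then (- (Num.sqrt 3)^-1, 0)
  else ((Num.sqrt 3)^-1, 0).

Definition Fi {R : realType} (i : 'I_3) (p : R * R) : R * R :=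
  ((p.1 + (qv i).1) / 2, (p.2 + (qv i).2) / 2).

Definition attractor {R : realType} (K : set (R * R)) : Prop :=
  [/\ K !=set0, compact K & K = \bigcup_(i in [set: 'I_3]) (Fi i @` K)].

(* Existence is [attractor_ex] below; uniqueness is Hutchinson's theorem. *)
Definition SG {R : realType} : set (R * R) := get (@attractor R).

Lemma continuous_pair_affine {R : realType} (c d : R) (e : R * R) :
  continuous (fun p : R * R => (p.1 * c + e.1, p.2 * d + e.2)).
Proof.
move=> p.
apply: (@cvg_pair _ _ _ _ (nbhs (p.1 * c + e.1)) (nbhs (p.2 * d + e.2))).
- apply: cvgD; last exact: cvg_cst.
  by apply: cvgM; [exact: cvg_fst|exact: cvg_cst].
- apply: cvgD; last exact: cvg_cst.
  by apply: cvgM; [exact: cvg_snd|exact: cvg_cst].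
Qed.

Definition Fi_inv {R : realType} (i : 'I_3) (p : R * R) : R * R :=
  (p.1 * 2 + (- qv i).1, p.2 * 2 + (- qv i).2).

Lemma FiK {R : realType} (i : 'I_3) : cancel (@Fi R i) (Fi_inv i).
Proof. by case=> u v; rewrite /Fi /Fi_inv /=; congr pair; field. Qed.

Lemma Fi_invK {R : realType} (i : 'I_3) : cancel (@Fi_inv R i) (Fi i).
Proof. by case=> u v; rewrite /Fi /Fi_inv /=; congr pair; field. Qed.

Lemma qv_bounds {R : realType} (i : 'I_3) :
  (-1 <= (@qv R i).1 <= 1) /\ (0 <= (@qv R i).2 <= 1).
Proof.
have s3 : 0 <= (Num.sqrt 3 : R)^-1 <= 1.
  have s1 : 1 <= (Num.sqrt 3 : R) by rewrite -[leLHS]sqrtr1 ler_sqrt; lra.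
  apply/andP; split; first by rewrite invr_ge0 sqrtr_ge0.
  by rewrite invf_le1; lra.
by rewrite /qv; case: ifP => _ /=; [|case: ifP => _ /=]; lra.
Qed.

Lemma attractor_ex {R : realType} : exists K : set (R * R), attractor K.
Proof.
pose B : set (R * R) := `[-1, 1] `*` `[0, 1].
pose Phi (A : set (R * R)) := \bigcup_(i in [set: 'I_3]) (Fi i @` A).
pose A n := iter n Phi B.
have PhiS (C D : set (R * R)) : C `<=` D -> Phi C `<=` Phi D.
  by move=> CD p [i _ [r Cr <-]]; exists i => //; exists r => //; exact: CD.
have PhiB : Phi B `<=` B.
  move=> _ [i _ [[u v] [/= + +] <-]]; rewrite !in_itv /= => u1 v1.
  have [h1 h2] := @qv_bounds R i.
  by split; rewrite /= in_itv /=; lra.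
have Adec n : A n.+1 `<=` A n by elim: n => [|n IH] //; exact: PhiS.
have Ale m n : (m <= n)%N -> A n `<=` A m.
  by move=> /subnK <-; elim: (n - m)%N => [|k IH] // p /Adec /IH.
have Bcpt : compact B by apply: compact_setX; exact: segment_compact.
have imE i (C : set (R * R)) : Fi i @` C = Fi_inv i @^-1` C.
  apply/seteqP; split=> [_ [r Cr <-]|p Cp]; first by rewrite /= FiK.
  by exists (Fi_inv i p) => //; exact: Fi_invK.
have Acl n : closed (A n).
  elim: n => [|n IH].
    apply: closedI.
      by apply: (@preimage_closed _ _ fst) => [p _|];
        [exact: cvg_fst|exact: interval_closed].
    by apply: (@preimage_closed _ _ snd) => [p _|];
      [exact: cvg_snd|exact: interval_closed].
  apply: closed_bigcup => [|i _]; [exact: finite_finset|rewrite imE].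
  by apply: preimage_closed => // p _; exact: continuous_pair_affine.
exists (\bigcap_n A n); split.
- exists (qv ord0) => n _; elim: n => [|n IH].
    by have [] := @qv_bounds R ord0; split; rewrite /= in_itv.
  exists ord0 => //; exists (qv ord0) => //.
  by rewrite /Fi /qv /=; congr pair; field.
- apply: (subclosed_compact _ Bcpt); first by apply: closed_bigI => n _.
  by move=> p /(_ 0%N); exact.
- apply/seteqP; split=> [p Kp|_ [i _ [r Kr <-]] [|n] _]; last first.
  + by exists i => //; exists r => //; exact: Kr.
  + by apply: PhiB; exists i => //; exists r => //; exact: (Kr 0%N).
  apply: contrapT => nK.
  have bad (i : 'I_3) : exists n, ~ A n (Fi_inv i p).
    apply/existsNP => Ai; apply: nK; exists i => //; exists (Fi_inv i p).
      by move=> n _; exact: Ai.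
    exact: Fi_invK.
  have [N NP] := choice bad.
  have [i _ [r Ar rp]] := Kp (\max_i N i).+1 Logic.I.
  apply: (NP i); rewrite -rp FiK; apply: Ale Ar.
  exact: leq_bigmax.
Qed.

Lemma SG_attractor {R : realType} : attractor (@SG R).
Proof. exact: getPex attractor_ex. Qed.

(* [Fword [:: i1; ..; in]] is F_i1 \o .. \o F_in. *)
Definition Fword {R : realType} (s : seq 'I_3) : R * R -> R * R :=
  foldr (fun i g => Fi i \o g) id s.

Definition cell {R : realType} (s : seq 'I_3) : set (R * R) := Fword s @` SG.

(* Vertices of the m-cells. *)
Definition Vn {R : realType} (m : nat) : set (R * R) :=
  [set p | exists (s : m.-tuple 'I_3) (i : 'I_3), p = Fword s (qv i)].

(* The graph Laplacian: the sum of u r - u p over the neighbours r of p in the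
   level-m graph. It is written as a sum over the m-cells having p as a vertex;
   two distinct m-cells have at most one common vertex, so that every neighbour
   is counted once. *)
Definition graph_laplacian {R : realType} (m : nat) (u : R * R -> R)
    (p : R * R) : R :=
  \sum_(s : m.-tuple 'I_3) \sum_(i < 3 | Fword s (qv i) == p)
    \sum_(j < 3 | j != i) (u (Fword s (qv j)) - u p).

(* Kigami's Laplacian on a relatively open subset U of SG \ V_0: the functions
   (3/2) 5^m Delta_m u converge to g, uniformly on V_m on each compact part of U.
   A compact K included in U is at positive distance from SG \ U, so the values
   of u outside U are irrelevant for large m. *)
Definition has_laplacian {R : realType} (U : set (R * R)) (u g : R * R -> R) :
    Prop :=
  [/\ {within U, continuous u}, {within U, continuous g} &
    forall K : set (R * R), compact K -> K `<=` U ->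
    forall eps : R, 0 < eps ->
    exists N : nat, forall m : nat, (N <= m)%N ->
    forall p : R * R, K p -> Vn m p ->
      `| 3 / 2 * 5 ^+ m * graph_laplacian m u p - g p | <= eps].

Definition Line {R : realType} (x : R) : set (R * R) :=
  [set p | p.2 = (qv ord0).2 - x].

Definition Omega {R : realType} (x : R) : set (R * R) :=
  SG `&` [set p | (qv ord0).2 - x < p.2].

Definition Sx {R : realType} (x : R) : set (R * R) := SG `&` Line x.

Definition harmonic {R : realType} (x : R) (u : R * R -> R) : Prop :=
  has_laplacian (Omega x `\ qv ord0) u (fun=> 0).

(* u is the harmonic function with the continuous boundary values a at q0 and
   g on S(x). *)
Definition harmonic_with_boundary {R : realType} (x a : R) (g u : R * R -> R) :
    Prop :=
  [/\ harmonic x u, {within Omega x `|` Sx x, continuous u},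
      u (qv ord0) = a & {in Sx x, u =1 g}].

Definition nondyadic {R : realType} (x : R) : Prop :=
  forall (k : int) (m : nat), x != k%:~R / 2 ^+ m.

Definition binary_digits {R : realType} (x : R) (n : nat -> nat) : Prop :=
  [/\ n 0%N = 0%N, forall k, (n k < n k.+1)%N &
      series (fun k => (2 ^- n k.+1 : R)) @ \oo --> x].

(* The letters 1, 2 are represented by the two elements of 'I_2 in this order;
   [lift ord0] sends them to the elements 1, 2 of 'I_3. *)
Definition word := seq 'I_2.
Definition letter1 : 'I_2 := ord0.
Definition letter2 : 'I_2 := ord_max.

(* The word over {0, 1, 2} such that Ftilde_w = Fword (tword n w); the
   auxiliary argument k is the number of letters already read. *)
Fixpoint tword_from (n : nat -> nat) (k : nat) (w : word) : seq 'I_3 :=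
  if w is i :: w' then
    nseq (n k.+1 - n k - 1) ord0 ++ lift ord0 i :: tword_from n k.+1 w'
  else [::].
Definition tword (n : nat -> nat) (w : word) : seq 'I_3 := tword_from n 0 w.

Definition Sw {R : realType} (x : R) (n : nat -> nat) (w : word) :
    set (R * R) :=
  Sx x `&` cell (tword n w).

Definition cantor_measure {R : realType} (x : R) (n : nat -> nat)
    (mu : probability (measurableTypeR R * measurableTypeR R)%type R) : Prop :=
  forall w : word, mu (Sw x n w) = (2 ^- size w)%:E.

Definition psi {R : realType} (x : R) (n : nat -> nat) (w : word)
    (p : R * R) : R :=
  Num.sqrt 2 ^+ size w *
  (\1_(Sw x n (rcons w letter1)) p - \1_(Sw x n (rcons w letter2)) p).

Definition square_integrable {R : realType} (x : R)
    (mu : probability (measurableTypeR R * measurableTypeR R)%type R)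
    (f : R * R -> R) : Prop :=
  measurable_fun (Sx x : set (measurableTypeR R * measurableTypeR R)) f /\
  mu.-integrable (Sx x) (fun p => (f p ^+ 2)%:E).

(* The coefficients of f on the elements 1 and psi_w of the Haar basis. *)
Definition haar_mean {R : realType} (x : R)
    (mu : probability (measurableTypeR R * measurableTypeR R)%type R)
    (f : R * R -> R) : R :=
  \int[mu]_(p in Sx x) f p.

Definition haar_coef {R : realType} (x : R) (n : nat -> nat)
    (mu : probability (measurableTypeR R * measurableTypeR R)%type R)
    (f : R * R -> R) (w : word) : R :=
  \int[mu]_(p in Sx x) (f p * psi x n w p).

(* At each point of Omega x only finitely many terms are nonzero, so the limit
   is that of an eventually constant sequence. *)
Definition haar_extension {R : realType} (a b : R) (c : word -> R)
    (h0 : R * R -> R) (hw : word -> R * R -> R) (p : R * R) : R :=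
  a * h0 p + b * (1 - h0 p) +
  limn (series (fun m => \sum_(w : m.-tuple 'I_2) c w * hw w p)).

Definition cell_energy {R : realType} (u : R * R -> R) (s : seq 'I_3) : R :=
  \sum_(i < 3) \sum_(j < 3 | (i < j)%N)
    (u (Fword s (qv i)) - u (Fword s (qv j))) ^+ 2.

Definition energy {R : realType} (x : R) (n : nat -> nat) (u : R * R -> R) :
    \bar R :=
  limn (fun m => ((5 / 3) ^+ n m *
    \sum_(s : (n m).-tuple 'I_3 | `[< cell s `<=` Omega x >])
      cell_energy u s)%:E).

Definition Qform {R : realType} (n : nat -> nat) (a b : R) (c : word -> R) :
    \bar R :=
  (((5 / 3) ^+ n 1%N * (a - b) ^+ 2)%:E +
   \sum_(0 <= m <oo)
     (\sum_(w : m.-tuple 'I_2)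
        2 ^+ m * (5 / 3) ^+ n m.+1 * `| c w | ^+ 2)%:E)%E.

(* Main.v *)
(* Cutting Omega x along the line gives a binary tree of triangles T_w, the cells
   Ftilde_w F_0^(n_(m+1) - n_m) (SG) with m = |w|: T_w has top vertex
   v_w = Ftilde_w q0, bottom vertices v_w1 and v_w2, and level n_(m+1). A
   harmonic u is determined on T_w by its three vertex values, so that the energy
   is the sum over w of (5/3)^n_(m+1) (2 M_w^2 + (3/2) D_w^2), where
   D_w = u(v_w1) - u(v_w2) and M_w is u(v_w) minus the mean of u(v_w1), u(v_w2).
   The balance of fluxes at v_wi reads
   M_wi = (rho/2) (M_w -+ (3/2) D_w), rho = (3/5)^(n_(m+2) - n_(m+1)) <= 3/5,
   whence the level sums of the M-part decay geometrically up to the D-part: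
   the energy is comparable to (5/3)^n_1 M_0^2 plus the sum of the D-part.
   A maximum principle on the tree makes the solution with given boundary values
   unique; the symmetries exchanging two sibling subtrees then show that M_0 only
   sees h0 and that D_w only sees h_w, with D_w comparable to 2^(m/2). *)

Require Import Defs.
From HB Require Import structures.
From mathcomp Require Import all_boot all_order all_algebra.
From mathcomp Require Import all_classical all_reals all_analysis.
From mathcomp Require Import ring lra zify.
Import Order.TTheory GRing.Theory Num.Theory.
Import numFieldNormedType.Exports.

Set Implicit Arguments.
Unset Strict Implicit.
Unset Printing Implicit Defensive.

Local Open Scope classical_set_scope.
Local Open Scope ring_scope.

(** * Words and barycentric coordinates *)

(** The balance of fluxes is an exact identity at one level, whereas the Laplacian is only a
    renormalised limit, uniform on compact sets. To come down from the limit, the level-m graph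
    Laplacian is paired with a piecewise harmonic bump at a vertex of level k: a discrete Green
    formula returns (3/5)^(m-k) times the level-k Laplacian there, while about 3^m terms, each
    o(5^-m), sum to o((3/5)^m). A second obstacle is [q0], which is excluded from the domain: a
    vertex lying on a cell through [q0] is out of reach of this argument until [q0] is shown to be
    removable. On the tree, h0 and h_w are measured along a single branch below which all gaps
    vanish: the drops then shrink by rho/2 <= 3/10 per step, so the total fall lies between the
    first drop and 1/(1 - 3/10) = 10/7 times it. The bounds on M_0 and D_w come from this ratio. The
    infinite expansion of h is handled level by level: on the cells of level n_m above the line it
    coincides with a finite truncation, because the later h_w vanish there. *)

Lemma sum_tuple0 (V : nmodType) (T : finType) (F : seq T -> V) :
  \sum_(s : 0.-tuple T) F s = F [::].
Proof.
rewrite (bigD1 [tuple]) //= big1 ?addr0 // => s.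
by have -> : s = [tuple] by exact: tuple0.
Qed.

Lemma sum_tuple_cons (V : nmodType) (T : finType) k (F : seq T -> V) :
  \sum_(s : k.+1.-tuple T) F s =
  \sum_(a : T) \sum_(s : k.-tuple T) F (a :: s).
Proof.
rewrite pair_big (reindex (fun p : T * k.-tuple T => cons_tuple p.1 p.2)) //=.
exists (fun s : k.+1.-tuple T => (thead s, behead_tuple s)) => [[a s] _|s _].
  by congr pair; apply: val_inj.
by rewrite [RHS]tuple_eta; apply: val_inj.
Qed.

Lemma sum_tuple_cat (V : nmodType) (T : finType) k i j (F : seq T -> V) :
  k = (i + j)%N ->
  \sum_(s : k.-tuple T) F s =
  \sum_(s : i.-tuple T) \sum_(v : j.-tuple T) F (s ++ v).
Proof.
move=> ->; elim: i F => [|i IH] F.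
  by rewrite (sum_tuple0 (fun s => \sum_(v : j.-tuple T) F (s ++ v))).
rewrite addSn sum_tuple_cons.
rewrite (sum_tuple_cons _ (fun s => \sum_(v : j.-tuple T) F (s ++ v))).
by apply: eq_bigr => a _; exact: (IH (fun s => F (a :: s))).
Qed.

Lemma sum_tuple_rcons (V : nmodType) (T : finType) k (F : seq T -> V) :
  \sum_(s : k.+1.-tuple T) F s =
  \sum_(s : k.-tuple T) \sum_(a : T) F (rcons s a).
Proof.
rewrite (@sum_tuple_cat _ _ _ k 1%N) ?addn1 //; apply: eq_bigr => s _.
rewrite (sum_tuple_cons _ (fun v => F (s ++ v))); apply: eq_bigr => a _.
by rewrite (sum_tuple0 (fun v => F (s ++ a :: v))) cats1.
Qed.

Lemma big_ord3 (V : nmodType) (F : 'I_3 -> V) :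
  \sum_(i < 3) F i = F ord0 + F (lift ord0 letter1) + F (lift ord0 letter2).
Proof.
rewrite !big_ord_recl big_ord0 addr0 addrA.
by congr (_ + F _ + F _); apply: val_inj.
Qed.

Lemma ord3P (P : 'I_3 -> Prop) :
  P ord0 -> P (lift ord0 letter1) -> P (lift ord0 letter2) -> forall i, P i.
Proof.
move=> P0 P1 P2; case=> [[|[|[|//]]] lti].
- by rewrite (_ : Ordinal lti = ord0) //; apply: val_inj.
- by rewrite (_ : Ordinal lti = lift ord0 letter1) //; apply: val_inj.
- by rewrite (_ : Ordinal lti = lift ord0 letter2) //; apply: val_inj.
Qed.

Lemma ord2P (P : 'I_2 -> Prop) : P letter1 -> P letter2 -> forall i, P i.
Proof.
move=> P1 P2; case=> [[|[|//]] lti].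
- by rewrite (_ : Ordinal lti = letter1) //; apply: val_inj.
- by rewrite (_ : Ordinal lti = letter2) //; apply: val_inj.
Qed.

Definition pt {R : realType} (s : seq 'I_3) (i : 'I_3) : R * R :=
  Fword s (qv i).

(* Barycentric coordinates with respect to q0, q1, q2. *)
Definition bary {R : realType} (l : 'I_3) (p : R * R) : R :=
  if l == 0%N :> nat then p.2
  else if l == 1%N :> nat then (1 - p.2 - Num.sqrt 3 * p.1) / 2
  else (1 - p.2 + Num.sqrt 3 * p.1) / 2.

(* Smallest values on the cell s of the barycentric coordinates, times 2 ^ |s|. *)
Definition bcoord (s : seq 'I_3) (l : 'I_3) : nat :=
  foldl (fun k a => (k.*2 + (a == l))%N) 0%N s.

Lemma bcoord_rcons s a l : bcoord (rcons s a) l = ((bcoord s l).*2 + (a == l))%N.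
Proof. by rewrite /bcoord -cats1 foldl_cat. Qed.

(** The last letter is read off from parity, exactly one of the three coordinates being odd; halving
    then removes it. *)
Lemma bcoord_inj s t : size s = size t -> bcoord s =1 bcoord t -> s = t.
Proof.
elim/last_ind: s t => [|s a IH] t; first by case: t.
elim/last_ind: t => [|t b _]; first by rewrite size_rcons.
rewrite !size_rcons => -[st] E.
have ab : a = b.
  apply/eqP; move: (E b); rewrite !bcoord_rcons eqxx.
  by case: eqP => //= _; lia.
rewrite -{}ab in E *; congr rcons; apply: IH => // l.
by move: (E l); rewrite !bcoord_rcons; lia.
Qed.

Section Geometry.
Variable R : realType.
Implicit Types (p : R * R) (s t r : seq 'I_3) (i j a b l : 'I_3).

Lemma sqrt3_gt0 : 0 < Num.sqrt 3 :> R.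
Proof. by rewrite sqrtr_gt0. Qed.

Lemma bary_qv l i : bary l (qv i : R * R) = (i == l)%:R.
Proof.
have s3 := sqrt3_gt0.
by elim/ord3P: l; elim/ord3P: i; rewrite /bary /qv /=; field; rewrite ?lt0r_neq0.
Qed.

Lemma bary_Fi l i p : bary l (Fi i p) = (bary l p + (i == l)%:R) / 2.
Proof.
have s3 := sqrt3_gt0.
by elim/ord3P: l; elim/ord3P: i; rewrite /bary /Fi /qv /=; field;
  rewrite ?lt0r_neq0.
Qed.

Lemma bary_inj p p' : bary^~ p =1 bary^~ p' -> p = p'.
Proof.
case: p p' => [y z] [y' z'] E; have s3 := sqrt3_gt0.
move: (E ord0) (E (lift ord0 letter2)); rewrite /bary /= => -> e2.
congr pair; apply: (mulfI (lt0r_neq0 s3)); lra.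
Qed.

Lemma bary_sum p : \sum_(l < 3) bary l p = 1.
Proof. by rewrite big_ord3 /bary /=; field. Qed.

Lemma Fword_cat s t p : Fword (s ++ t) p = Fword s (Fword t p).
Proof. by elim: s => //= a s ->. Qed.

Lemma Fword_rcons s a p : Fword (rcons s a) p = Fword s (Fi a p).
Proof. by rewrite -cats1 Fword_cat. Qed.

Lemma Fword_inj s : injective (Fword s : R * R -> R * R).
Proof.
by elim: s => [//|a s IH] p p' /= /(can_inj (@FiK R a)); exact: IH.
Qed.

Lemma bary_Fword l s p :
  bary l (Fword s p) = ((bcoord s l)%:R + bary l p) / 2 ^+ size s.
Proof.
elim/last_ind: s p => [|s a IH] p; first by rewrite /= add0r divr1.
rewrite Fword_rcons IH bary_Fi bcoord_rcons size_rcons exprS.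
rewrite -muln2 natrD natrM; field.
by rewrite expf_neq0.
Qed.

Lemma bary_pt l s i :
  bary l (pt s i : R * R) = (bcoord s l + (i == l))%:R / 2 ^+ size s.
Proof. by rewrite bary_Fword bary_qv natrD. Qed.

Lemma pt_eqP s t i j : size s = size t ->
  (pt s i = pt t j :> R * R) <->
  (forall l, bcoord s l + (i == l) = bcoord t l + (j == l))%N.
Proof.
move=> st; split=> [E l|E].
  have := congr1 (bary l) E; rewrite !bary_pt st.
  move=> /(mulIf (invr_neq0 (expf_neq0 _ _))) => /(_ _)/eqP.
  by rewrite eqr_nat => H; apply/eqP; apply: H; rewrite pnatr_eq0.
by apply: bary_inj => l; rewrite !bary_pt E st.
Qed.

Lemma Fi_qv i : Fi i (qv i) = qv i :> R * R.
Proof. by apply: bary_inj => l; rewrite bary_Fi !bary_qv; field. Qed.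

Lemma Fi_qvC i j : Fi i (qv j) = Fi j (qv i) :> R * R.
Proof. by apply: bary_inj => l; rewrite !bary_Fi !bary_qv; field. Qed.

Lemma pt_rcons s a : pt (rcons s a) a = pt s a :> R * R.
Proof. by rewrite /pt Fword_rcons Fi_qv. Qed.

Lemma pt_rconsC s a b : pt (rcons s a) b = pt (rcons s b) a :> R * R.
Proof. by rewrite /pt !Fword_rcons Fi_qvC. Qed.

Lemma nseqSr (T : Type) k (y : T) : nseq k.+1 y = rcons (nseq k y) y.
Proof. by elim: k => //= k ->. Qed.

Lemma pt_cat_nseq s a k : pt (s ++ nseq k a) a = pt s a :> R * R.
Proof.
elim: k => [|k IH]; first by rewrite cats0.
by rewrite nseqSr -rcons_cat pt_rcons.
Qed.

(** Parity again: [i = a] makes all coordinates even and the point is a vertex of the parent;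
    otherwise the odd coordinates are those of [a] and [i], so the point is the midpoint of a side,
    which determines the parent. *)
Lemma pt_rcons_eq s t a b i j : size s = size t ->
  pt (rcons s a) i = pt (rcons t b) j :> R * R ->
  [/\ i = a, j = b & pt s a = pt t b :> R * R] \/
  [/\ i != a, s = t & (a = b /\ i = j) \/ (a = j /\ i = b)].
Proof.
move=> st /(@pt_eqP _ _ _ _ _) E.
have {}E l : ((bcoord s l).*2 + (a == l) + (i == l) =
              (bcoord t l).*2 + (b == l) + (j == l))%N.
  by rewrite -!bcoord_rcons E // !size_rcons st.
have [ia|ia] := eqVneq i a; [left|right].
  have jb : j = b.
    apply/eqP; move: (E b); rewrite ia eqxx.
    by case: (j =P b) => //= _; case: (a == b); lia.
  split=> //; apply/pt_eqP => // l.
  by move: (E l); rewrite ia jb; lia.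
have abj : (a = b /\ i = j) \/ (a = j /\ i = b).
  have [ab|ab] := eqVneq a b.
    left; split=> //; apply/eqP; move: (E i); rewrite -ab eqxx.
    rewrite (eq_sym a) (negPf ia) (eq_sym i j).
    by case: (j == i) => //=; lia.
  right; have aj : a = j.
    apply/eqP; move: (E a).
    rewrite eqxx (negPf ia) (eq_sym b) (negPf ab) (eq_sym j).
    by case: (a == j) => //=; lia.
  split=> //; apply/eqP; move: (E i); rewrite -aj eqxx.
  rewrite (eq_sym a) (negPf ia) (eq_sym i b).
  by case: (b == i) => //=; lia.
split=> //; apply: bcoord_inj => // l; move: (E l).
by case: abj => -[-> ->]; lia.
Qed.

Lemma pt_junctionE r a b k : pt (r ++ a :: nseq k b) b = pt (rcons r a) b :> R * R.
Proof. by rewrite -cat_rcons pt_cat_nseq. Qed.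

Lemma pt_junctionC r a b k :
  pt (r ++ a :: nseq k b) b = pt (r ++ b :: nseq k a) a :> R * R.
Proof. by rewrite !pt_junctionE pt_rconsC. Qed.

(** The midpoint of a side of the cell [r] lies in exactly two cells of each finer level, so that
    the graph Laplacian there consists of two fluxes. *)
Lemma pt_junction r t a b j k : a != b -> size t = (size r + k).+1 ->
  pt (r ++ a :: nseq k b) b = pt t j :> R * R ->
  (t = r ++ a :: nseq k b /\ j = b) \/ (t = r ++ b :: nseq k a /\ j = a).
Proof.
move=> ab; elim: k t j => [|k IH] t j.
  elim/last_ind: t => [//|t c _]; rewrite !cats1 size_rcons addn0 => -[st].
  move=> /pt_rcons_eq [//|[ba]|[_ -> [[-> ->]|[-> ->]]]]; [|by left|by right].
  by rewrite ba eqxx in ab.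
elim/last_ind: t => [//|t c _]; rewrite size_rcons => -[st].
rewrite !nseqSr -!rcons_cons -!rcons_cat => /pt_rcons_eq [].
- by rewrite size_cat /= size_nseq st; lia.
- by case=> _ -> /IH [|[-> ->]|[-> ->]]; [lia|left|right].
- by case; rewrite eqxx.
Qed.

End Geometry.

(** * Topology of the gasket *)

Section Gasket.
Variable R : realType.
Implicit Types (p : R * R) (s t r : seq 'I_3) (i j a b l : 'I_3).

Lemma SG_Fi i p : SG p -> SG (Fi i p).
Proof.
have [_ _ E] := @SG_attractor R.
by rewrite {2}E => Sp; exists i => //; exists p.
Qed.

Lemma SG_Fi_inv p : SG p -> exists i q, SG q /\ p = Fi i q.
Proof.
have [_ _ E] := @SG_attractor R.
by rewrite {1}E => -[i _ [q Sq <-]]; exists i, q.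
Qed.

Lemma continuous_bary l : continuous (bary l : R * R -> R).
Proof.
elim/ord3P: l => p; rewrite /bary /=; first exact: cvg_snd.
- apply: cvgM; last exact: cvg_cst.
  apply: cvgB; last by apply: cvgM; [exact: cvg_cst|exact: cvg_fst].
  by apply: cvgB; [exact: cvg_cst|exact: cvg_snd].
- apply: cvgM; last exact: cvg_cst.
  apply: cvgD; last by apply: cvgM; [exact: cvg_cst|exact: cvg_fst].
  by apply: cvgB; [exact: cvg_cst|exact: cvg_snd].
Qed.

Lemma SG_compact : compact (SG : set (R * R)).
Proof. by have [] := @SG_attractor R. Qed.

Lemma SG_nonempty : (SG : set (R * R)) !=set0.
Proof. by have [] := @SG_attractor R. Qed.

(** By self-similarity, a minimum c over the compact gasket satisfies c >= c / 2. *)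
Lemma SG_bary_ge0 l p : SG p -> 0 <= bary l p.
Proof.
have [z /set_mem zS zmin] := compact_EVT_min SG_nonempty SG_compact
  (continuous_subspaceT (@continuous_bary l)).
move=> /mem_set /zmin; apply: le_trans.
have [i [y [/mem_set /zmin yS zE]]] := SG_Fi_inv zS.
by move: yS; rewrite zE bary_Fi; case: (i == l) => /=; lra.
Qed.

Lemma SG_bary_le1 l p : SG p -> bary l p <= 1.
Proof.
move=> Sp; rewrite -(bary_sum p) (bigD1 l) //= lerDl.
by apply: sumr_ge0 => k _; exact: SG_bary_ge0.
Qed.

Lemma SG_bary1 l p : SG p -> bary l p = 1 -> p = qv l.
Proof.
move=> Sp pl; apply: bary_inj => k; rewrite bary_qv.
have [lk|lk] := eqVneq l k; first by rewrite -lk pl.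
move: (bary_sum p); rewrite (bigD1 l) //= (bigD1 k) 1?eq_sym //= pl => E.
have : 0 <= bary k p by exact: SG_bary_ge0.
have : 0 <= \sum_(i < 3 | (i != l) && (i != k)) bary i p.
  by apply: sumr_ge0 => j _; exact: SG_bary_ge0.
move: E; lra.
Qed.

(** Applying [Fi i] to a maximum point shows c >= (c + 1) / 2 for the maximum c of the i-th
    coordinate; hence c = 1, which is attained only at the vertex. *)
Lemma SG_qv i : SG (qv i : R * R).
Proof.
have [z /set_mem zS zmax] := compact_EVT_max SG_nonempty SG_compact
  (continuous_subspaceT (@continuous_bary i)).
rewrite -(SG_bary1 zS) //.
have /mem_set/zmax := SG_Fi i zS; rewrite bary_Fi eqxx /= => h.
by have := SG_bary_le1 i zS; lra.
Qed.

Lemma SG_Fword s p : SG p -> SG (Fword s p).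
Proof. by elim: s => //= a s IH Sp; apply: SG_Fi; exact: IH. Qed.

Lemma cell_cat s t : cell (s ++ t) `<=` (cell s : set (R * R)).
Proof.
move=> _ [p Sp <-]; rewrite Fword_cat; exists (Fword t p) => //.
exact: SG_Fword.
Qed.

Lemma cell_SG s : cell s `<=` (SG : set (R * R)).
Proof. by move=> _ [p Sp <-]; exact: SG_Fword. Qed.

Lemma cell_pt s i : (cell s : set (R * R)) (pt s i).
Proof. by exists (qv i) => //; exact: SG_qv. Qed.

Lemma continuous_Fi i : continuous (Fi i : R * R -> R * R).
Proof.
have -> : (Fi i : R * R -> R * R) =
    (fun p => (p.1 * 2^-1 + (((qv i).1 / 2, (qv i).2 / 2) : R * R).1,
               p.2 * 2^-1 + (((qv i).1 / 2, (qv i).2 / 2) : R * R).2)).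
  by apply: funext => p; rewrite /Fi !mulrDl.
exact: continuous_pair_affine.
Qed.

Lemma continuous_Fword s : continuous (Fword s : R * R -> R * R).
Proof.
elim: s => [|a s IH] p /=; first exact: cvg_id.
by apply: continuous_comp; [exact: IH|exact: continuous_Fi].
Qed.

Lemma cell_compact s : compact (cell s : set (R * R)).
Proof.
apply: continuous_compact SG_compact.
exact: continuous_subspaceT (@continuous_Fword s).
Qed.

Lemma height_compact s (c : R) :
  compact (cell s `&` [set p : R * R | c <= p.2]).
Proof.
apply: (subclosed_compact _ (@cell_compact s)); last exact: subIsetl.
apply: closedI; first by apply: compact_closed;
  [exact: norm_hausdorff|exact: cell_compact].
apply: (@preimage_closed _ _ snd [set y | c <= y]) => [p _|].
  exact: cvg_snd.
exact: closed_ge.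
Qed.

(** Compactness makes the approach to the slice of height [c] uniform. It serves twice: for the
    boundary values on the line, and at the top, where the slice is the single point [q0]. *)
Lemma within_height_cvg (A B : set (R * R)) (u : R * R -> R) (c k e : R) :
  {within A, continuous u} -> compact B -> B `<=` A ->
  (forall p, B p -> p.2 = c -> u p = k) -> 0 < e ->
  exists2 d, 0 < d & forall p, B p -> `|p.2 - c| < d -> `|u p - k| < e.
Proof.
move=> uc /compact_near_coveringP Bc BA Bk e0.
have : \forall d \near (0 : R)^'+,
    B `<=` (fun p => B p -> `|p.2 - c| < d -> `|u p - k| < e).
  apply: Bc => p Bp.
  have [pc|pc] := eqVneq p.2 c.
    move/subspace_continuousP: uc => /(_ _ (BA _ Bp)) /cvgrPdist_lt /(_ _ e0).
    rewrite /from_subspace (Bk _ Bp pc) near_withinE => H.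
    exists ([set q | A q -> `|k - u q| < e], setT).
      by split => //; exact: filterT.
    by move=> [q d] /= [Hq _] Bq _; rewrite distrC; exact/Hq/BA.
  have pc0 : 0 < `|p.2 - c| / 2 by rewrite divr_gt0 // normr_gt0 subr_eq0.
  exists ([set q | `|p.2 - q.2| < `|p.2 - c| / 2],
          [set d | d < `|p.2 - c| / 2]) => /=.
    split; last exact: nbhs_right_lt.
    have : (fun q : R * R => q.2) @ p --> p.2 by exact: cvg_snd.
    by move=> /cvgrPdist_lt /(_ _ pc0).
  move=> [q d] /= [Hq Hd] Bq qd; exfalso.
  have := ler_distD q.2 p.2 c; lra.
rewrite near_withinE => -[d /= d0 Hd]; exists (d / 2); first exact: divr_gt0.
move=> p Bp pc; apply: (Hd (d / 2)) => //.
- by rewrite /ball_ /= sub0r normrN gtr0_norm ?divr_gt0 // ltr_pdivrMr //; lra.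
- exact: divr_gt0.
Qed.
End Gasket.

(** * From the Laplacian to the graph Laplacians *)

Section Laplacian.
Variable R : realType.
Implicit Types (p q : R * R) (u : R * R -> R) (s t r : seq 'I_3).
Implicit Types (i j a b l : 'I_3) (phi : 'I_3 -> R).

(** Up to sign and renormalisation, the normal derivative at a corner of the cell. *)
Definition flux u s i : R := \sum_(j < 3 | j != i) (u (pt s j) - u (pt s i)).

Lemma fluxE u s i : flux u s i = \sum_(j < 3) u (pt s j) - 3 * u (pt s i).
Proof.
transitivity (\sum_(j < 3) (u (pt s j) - u (pt s i))).
  by rewrite (bigD1 i) //= subrr add0r.
by rewrite sumrB sumr_const card_ord mulr_natl.
Qed.

Lemma graph_laplacianE m u p :
  graph_laplacian m u p =
  \sum_(s : m.-tuple 'I_3) \sum_(i < 3) (pt s i == p)%:R * flux u s i.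
Proof.
apply: eq_bigr => s _; rewrite big_mkcond; apply: eq_bigr => i _.
by rewrite -/(pt s i); case: eqP => [<-|_]; rewrite ?mul1r ?mul0r.
Qed.

Lemma laplacian_junction m u r a b k : a != b -> m = (size r + k).+1 ->
  graph_laplacian m u (pt (r ++ a :: nseq k b) b) =
  flux u (r ++ a :: nseq k b) b + flux u (r ++ b :: nseq k a) a.
Proof.
move=> ab mE.
have szE c d : size (r ++ c :: nseq k d) == m.
  by rewrite size_cat /= size_nseq mE; apply/eqP; lia.
pose x1 : m.-tuple 'I_3 * 'I_3 := (Tuple (szE a b), b).
pose x2 : m.-tuple 'I_3 * 'I_3 := (Tuple (szE b a), a).
rewrite graph_laplacianE pair_big /= (bigD1 x1) //= (bigD1 x2) /=; last first.
  by apply/eqP => -[] _ /eqP; rewrite (negPf ab).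
have E12 : pt (r ++ b :: nseq k a) a = pt (r ++ a :: nseq k b) b :> R * R.
  by rewrite !pt_junctionE pt_rconsC.
rewrite eqxx mul1r E12 eqxx mul1r big1 ?addr0 //.
case=> s i /= /andP[n1 n2]; case: eqP => [E|]; last by rewrite mul0r.
move: (esym E) => /(pt_junction ab) []; first by rewrite size_tuple mE.
- case=> sE iE; move: n1; rewrite /x1 iE.
  by rewrite (_ : s = Tuple (szE a b)) ?eqxx //; apply: val_inj.
- case=> sE iE; move: n2; rewrite /x2 iE.
  by rewrite (_ : s = Tuple (szE b a)) ?eqxx //; apply: val_inj.
Qed.

(** For [i != a] this is the harmonic extension rule: weights 2/5, 2/5 for the ends of the side and
    1/5 for the opposite vertex. *)
Definition refine phi a i : R :=
  if i == a then phi a else (phi a + phi i + \sum_(l < 3) phi l) / 5.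

(* The function, harmonic on each k-cell, with vertex values Phi on the k-cells;
   [spline k Phi s i] is its value at the i-th vertex of the cell s. *)
Definition spline k (Phi : seq 'I_3 -> 'I_3 -> R) s : 'I_3 -> R :=
  foldl refine (Phi (take k s)) (drop k s).

Definition consistent m (Phi : seq 'I_3 -> 'I_3 -> R) : Prop :=
  forall s t i j, size s = m -> size t = m ->
  pt s i = pt t j :> R * R -> Phi s i = Phi t j.

Lemma spline_rcons k Phi s a : (k <= size s)%N ->
  spline k Phi (rcons s a) = refine (spline k Phi s) a.
Proof.
move=> ks; rewrite /spline -cats1 takel_cat // drop_cat.
case: ltnP => [_|sk]; first by rewrite foldl_cat.
have -> : k = size s by apply/eqP; rewrite eqn_leq ks sk.
by rewrite subnn drop0 drop_size.
Qed.

Lemma spline_size k Phi s : size s = k -> spline k Phi s = Phi s.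
Proof. by move=> <-; rewrite /spline take_size drop_size. Qed.

Lemma refineC phi a i : refine phi a i = refine phi i a.
Proof.
rewrite /refine eq_sym; case: eqP => [->//|_]; congr (_ / _); ring.
Qed.

Lemma spline_consistent k (j : nat) Phi : consistent k Phi ->
  consistent (k + j)%N (spline k Phi).
Proof.
move=> cPhi; elim: j => [|j IH] s t i l.
  rewrite addn0 => sk tk; rewrite !spline_size //; exact: cPhi.
rewrite addnS; elim/last_ind: s => [//|s a _]; elim/last_ind: t => [//|t b _].
rewrite !size_rcons => -[sm] [tm].
rewrite !spline_rcons ?sm ?tm ?leq_addr //.
move=> /pt_rcons_eq [|[-> -> E]|[_ -> [[-> ->]|[-> ->]]]] //.
- by rewrite sm tm.
- by rewrite /refine !eqxx; exact: IH.
- by rewrite refineC.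
Qed.

(** Both sums are, up to sign, graph energy forms of [phi] and [u]. The refined function is harmonic
    at the midpoints, so the values of [u] there drop out. *)
Lemma flux_refine u phi s :
  \sum_(a < 3) \sum_(i < 3) refine phi a i * flux u (rcons s a) i =
  3 / 5 * \sum_(i < 3) phi i * flux u s i.
Proof.
under eq_bigr => a _ do under eq_bigr => i _ do rewrite fluxE.
under [in RHS]eq_bigr => i _ do rewrite fluxE.
rewrite /refine !big_ord3 /= !pt_rcons.
rewrite (pt_rconsC _ s (lift ord0 letter1) ord0).
rewrite (pt_rconsC _ s (lift ord0 letter2) ord0).
rewrite (pt_rconsC _ s (lift ord0 letter2) (lift ord0 letter1)).
by field.
Qed.

Lemma spline_flux u k (j : nat) Phi :
  \sum_(s : (k + j).-tuple 'I_3) \sum_(i < 3) spline k Phi s i * flux u s i =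
  (3 / 5) ^+ j * \sum_(s : k.-tuple 'I_3) \sum_(i < 3) Phi s i * flux u s i.
Proof.
elim: j => [|j IH].
  rewrite expr0 mul1r addn0; apply: eq_bigr => s _; apply: eq_bigr => i _.
  by rewrite spline_size ?size_tuple.
rewrite addnS exprS -mulrA -IH mulr_sumr.
rewrite (sum_tuple_rcons _ (fun s => \sum_i spline k Phi s i * flux u s i)).
apply: eq_bigr => s _; rewrite -flux_refine; apply: eq_bigr => a _.
by rewrite spline_rcons // size_tuple leq_addr.
Qed.

Lemma sum_fibers (T : finType) (P : eqType) (f : T -> P) (w g : T -> R) :
  (forall x y, f x = f y -> w x = w y) ->
  \sum_x w x * g x =
  \sum_x w x / #|[pred y | f y == f x]|%:R * \sum_(y | f y == f x) g y.
Proof.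
move=> fw; under [RHS]eq_bigr => x _ do rewrite mulr_sumr.
rewrite (exchange_big_dep xpredT) //=; apply: eq_bigr => y _.
under eq_bigr => x /eqP yx.
  rewrite -yx (fw _ _ (esym yx)); over.
rewrite sumr_const (eq_card (_ : _ =i [pred x | f x == f y])); last first.
  by move=> x; rewrite !inE eq_sym.
set c := #|_|; have c0 : c%:R != 0 :> R.
  by rewrite pnatr_eq0 -lt0n; apply/card_gt0P; exists y; rewrite inE.
by rewrite -mulr_natr; field.
Qed.

(** A consistent [w] depends on the point only, so fluxes at a common vertex can be grouped into the
    graph Laplacian; [c s i] is the reciprocal of the number of pairs (cell, corner) that represent
    this vertex. *)
Lemma sum_fibers_flux m u (w : seq 'I_3 -> 'I_3 -> R) : consistent m w ->
  exists c : m.-tuple 'I_3 -> 'I_3 -> R,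
    (forall (s : m.-tuple 'I_3) i, 0 <= c s i <= 1) /\
    \sum_(s : m.-tuple 'I_3) \sum_(i < 3) w s i * flux u s i =
    \sum_(s : m.-tuple 'I_3) \sum_(i < 3)
      c s i * w s i * graph_laplacian m u (pt s i).
Proof.
move=> cw; pose f (x : m.-tuple 'I_3 * 'I_3) := pt x.1 x.2 : R * R.
exists (fun (s : m.-tuple _) i => (#|[pred y | f y == f (s, i)]|%:R)^-1); split.
  move=> s i; set c := #|_|; have c0 : (0 < c)%N.
    by apply/card_gt0P; exists (s, i); rewrite inE.
  by rewrite invr_ge0 ler0n invf_le1 ?ltr0n // ler1n.
rewrite !pair_big /= (sum_fibers (f := f)); last first.
  by case=> s i [t j]; apply: cw; rewrite size_tuple.
apply: eq_bigr => -[s i] _ /=; rewrite [_^-1 * _]mulrC; congr (_ * _).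
rewrite graph_laplacianE pair_big /= big_mkcond; apply: eq_bigr => y _.
by rewrite /f /=; case: (_ == _); rewrite ?mul1r ?mul0r.
Qed.

(** The test function: 1 at [p], 0 at the other vertices of level [k], harmonic inside each
    k-cell. *)
Definition bump k p : seq 'I_3 -> 'I_3 -> R :=
  spline k (fun s i => (pt s i == p)%:R).

Lemma bump_consistent k (j : nat) p : consistent (k + j) (bump k p).
Proof. by apply: spline_consistent => s t i l _ _ ->. Qed.

Lemma bump_flux u k (j : nat) p :
  \sum_(s : (k + j).-tuple 'I_3) \sum_(i < 3) bump k p s i * flux u s i =
  (3 / 5) ^+ j * graph_laplacian k u p.
Proof. by rewrite spline_flux graph_laplacianE. Qed.

Lemma refine_itv phi a i : (forall l, 0 <= phi l <= 1) -> 0 <= refine phi a i <= 1.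
Proof.
move=> h; rewrite /refine; case: eqP => // _; rewrite big_ord3.
have := h ord0; have := h (lift ord0 letter1); have := h (lift ord0 letter2).
by have := h a; have := h i; lra.
Qed.

Lemma bump_itv k p s i : 0 <= bump k p s i <= 1.
Proof.
rewrite /bump /spline; move: (take k s) (drop k s) => r t.
elim/last_ind: t i => [|t a IH] i.
  by rewrite /=; case: (_ == _); rewrite /= ?lexx ?ler01.
by rewrite -cats1 foldl_cat; apply: refine_itv.
Qed.

Lemma bump_support k p s i : bump k p s i != 0 ->
  exists l, pt (take k s) l = p.
Proof.
apply: contra_neqP => /forallNP H; rewrite /bump /spline.
elim/last_ind: (drop k s) i => [|t a IH] i /=.
  by case: eqP (H i) => // ->.
by rewrite -cats1 foldl_cat /= /refine !IH big1 ?addr0 ?mul0r ?if_same.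
Qed.

(** Pairing with the bump at level m = k + N expresses (3/5)^N times the level-k Laplacian as a sum
    over corners in which each graph Laplacian is o(5^-m). *)
Lemma has_laplacian0_vertex (U : set (R * R)) u k p :
  has_laplacian U u (fun=> 0) ->
  (forall s i, size s = k -> pt s i = p -> cell s `<=` U) ->
  graph_laplacian k u p = 0.
Proof.
case=> _ _ HL kU.
pose P := [pred s : k.-tuple 'I_3 | `[< exists i, pt s i = p >]].
(* The k-cells around [p] form a compact set that carries the bump. *)
pose K := \bigcup_(s in [set` P]) (cell s : set (R * R)).
have Kc : compact K.
  by rewrite /K bigcup_pred; apply: bigsetU_compact => s _; exact: cell_compact.
have KU : K `<=` U.
  move=> q [s /asboolP[i ip]] sq.
  by apply: (kU s i) => //; rewrite size_tuple.
apply/eqP; rewrite -normr_le0; apply/ler_addgt0Pr => e e0; rewrite add0r.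
have [N HN] := HL K Kc KU (e / 3) (divr_gt0 e0 (ltr0Sn _ _)).
pose m := (k + N)%N.
have E := bump_flux u k N p.
have [c [c01 cE]] := sum_fibers_flux u (@bump_consistent k N p).
have tE (s : m.-tuple 'I_3) i :
    `|c s i * bump k p s i * graph_laplacian m u (pt s i)| <= e / 3 / 5 ^+ m.
  have [->|w0] := eqVneq (bump k p s i) 0.
    by rewrite mulr0 mul0r normr0 divr_ge0 ?exprn_ge0 ?divr_ge0 // ltW.
  have [l lp] := bump_support w0.
  have tk : size (take k s) == k by rewrite size_takel ?size_tuple ?leq_addr.
  have Ks : K (pt s i).
    exists (Tuple tk); first by apply/asboolP; exists l.
    by apply: (@cell_cat _ _ (drop k s)); rewrite cat_take_drop; exact: cell_pt.
  have := HN m (leq_addl _ _) _ Ks (ex_intro _ s (ex_intro _ i erefl)).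
  rewrite subr0 -mulrA normrM [`|3 / 2|]gtr0_norm ?divr_gt0 // => H.
  have cw : `|c s i * bump k p s i| <= 1.
    have /andP[c0 c1] := c01 s i; have /andP[b0 b1] := bump_itv k p s i.
    by rewrite ger0_norm ?mulr_ge0 // mulr_ile1.
  have p5 : 0 < (5 : R) ^+ m by rewrite exprn_gt0.
  rewrite ler_pdivlMr // normrM mulrC.
  move: H; rewrite normrM (gtr0_norm p5); set L := `|graph_laplacian _ _ _| => H.
  have L0 : 0 <= 5 ^+ m * L by rewrite mulr_ge0 ?normr_ge0 // ltW.
  have : `|c s i * bump k p s i| * (5 ^+ m * L) <= 5 ^+ m * L by apply: ler_piMl.
  rewrite mulrCA; lra.
have q0 : 0 < (3 / 5 : R) ^+ N by rewrite exprn_gt0 // divr_gt0.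
rewrite -(ler_pM2l q0) -[leLHS]ger0_norm; last first.
  by rewrite mulr_ge0 // ltW.
rewrite normrM normr_id -normrM -E cE.
(* There are 3 * 3^m corners, hence the total (3/5)^m e, at most (3/5)^N e since m = k + N. *)
apply: (@le_trans _ _ (\sum_(s : m.-tuple 'I_3) \sum_(i < 3) (e / 3 / 5 ^+ m))).
  apply: le_trans (ler_norm_sum _ _ _) _; apply: ler_sum => s _.
  by apply: le_trans (ler_norm_sum _ _ _) _; apply: ler_sum => i _; exact: tE.
rewrite !sumr_const card_tuple !card_ord -!mulrnA -[leLHS]mulr_natr natrM natrX.
have -> : e / 3 / 5 ^+ m * (3 * 3 ^+ m) = (3 / 5) ^+ m * e.
  by rewrite expr_div_n; field; rewrite expf_neq0.
rewrite ler_wpM2r ?(ltW e0) // ler_wiXn2l ?leq_addl //; lra.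
Qed.

Lemma pt_inj s : injective (pt s : 'I_3 -> R * R).
Proof.
move=> i j /Fword_inj E; apply/eqP; move: (congr1 (bary j) E).
rewrite !bary_qv eqxx; case: eqP => // _ /eqP.
by rewrite eq_sym oner_eq0.
Qed.

Lemma pt_nseq m a : pt (nseq m a) a = qv a :> R * R.
Proof. exact: (@pt_cat_nseq R [::]). Qed.

Lemma cell_q0 s : cell s (qv ord0 : R * R) -> s = nseq (size s) ord0.
Proof.
elim: s => [//|a s IH] [z Sz /= E].
have := congr1 (bary ord0) E; rewrite bary_Fi bary_qv eqxx /= => E1.
have h1 : bary ord0 (Fword s z) <= 1 by apply: SG_bary_le1; exact: SG_Fword.
have a0 : a == ord0 by move: E1; case: (a == ord0) => //=; lra.
rewrite (eqP a0) -IH //; exists z => //; apply: SG_bary1.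
  exact: SG_Fword.
by move: E1; rewrite a0 /=; lra.
Qed.

(** With value 0 at [q0] and values at most c at the two other corners, the extension rule gives at
    most 3c/5 on the next cell at [q0]. *)
Lemma bump_nseq k (j : nat) p : p != qv ord0 ->
  bump k p (nseq (k + j) ord0) ord0 = 0 /\
  forall i, bump k p (nseq (k + j) ord0) i <= (3 / 5) ^+ j.
Proof.
move=> pq; elim: j => [|j [IH0 IH]].
  rewrite addn0 /bump spline_size ?size_nseq // pt_nseq eq_sym (negPf pq).
  by split=> // i; case: (_ == _); rewrite expr0 ?ler01.
rewrite addnS nseqSr /bump spline_rcons ?size_nseq ?leq_addr // -/(bump k p _).
rewrite /refine eqxx; split=> [//|i].
have := IH (lift ord0 letter1); have := IH (lift ord0 letter2).
have p0 : 0 <= (3 / 5 : R) ^+ j by rewrite exprn_ge0 // divr_ge0.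
rewrite exprS; elim/ord3P: i => /=; rewrite ?big_ord3 ?IH0; lra.
Qed.

Lemma flux_le u s (c e : R) i : (forall z, cell s z -> `|u z - c| < e) ->
  `|flux u s i| <= 4 * e.
Proof.
move=> H.
have D j : `|u (pt s j) - u (pt s i)| <= 2 * e.
  have -> : u (pt s j) - u (pt s i) = (u (pt s j) - c) - (u (pt s i) - c).
    by ring.
  apply: le_trans (ler_normB _ _) _.
  by have := H _ (cell_pt _ s j); have := H _ (cell_pt _ s i); lra.
rewrite /flux; apply: le_trans (ler_norm_sum _ _ _) _.
apply: le_trans (ler_sum _ (fun j _ => D j)) _.
rewrite sumr_const (eq_card (_ : _ =i predC1 i)) ?cardC1 ?card_ord //.
by rewrite mulr2n; lra.
Qed.

(* A vertex q0 where u is continuous is a removable singularity: the bump at p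
   is O((3/5)^j) at the vertices of the level k + j neighbouring q0, where the
   graph Laplacian of u tends to 0. *)
Lemma removable_vertex (W : set (R * R)) u k p :
  (forall e : R, 0 < e -> exists M, forall m, (M <= m)%N -> forall z,
     cell (nseq m ord0) z -> `|u z - u (qv ord0)| < e) ->
  (forall m q,
     (forall s i, size s = m -> pt s i = q -> cell s `<=` W `\ qv ord0) ->
     graph_laplacian m u q = 0) ->
  p != qv ord0 -> (forall s i, size s = k -> pt s i = p -> cell s `<=` W) ->
  graph_laplacian k u p = 0.
Proof.
move=> uc H pq kW.
apply/eqP; rewrite -normr_le0; apply/ler_addgt0Pr => e e0; rewrite add0r.
(* A flux is at most 4 (e/16), and two fluxes occur at each of the two neighbours of [q0]. *)
have [M HM] := uc (e / 16) (divr_gt0 e0 (ltr0Sn _ _)).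
pose N := (k + M)%N; pose z0 := nseq N (ord0 : 'I_3).
pose o (l : 'I_2) : 'I_3 := lift ord0 l.
have z0E : z0 ++ [:: ord0] = nseq (k + M.+1) ord0 by rewrite addnS nseqSr cats1.
(* In the support of the bump, [H] can fail only at the corners of the cell at [q0]: these two
   points, and [q0] itself, where the bump vanishes. *)
pose q (l : 'I_2) : R * R := pt (z0 ++ ord0 :: nseq 0 (o l)) (o l).
have qle (l : 'I_2) : `|graph_laplacian (k + M.+1) u (q l)| <= e / 2.
  rewrite laplacian_junction ?addnS ?size_nseq ?addn0 //.
  have F a i : `|flux u (z0 ++ [:: a]) i| <= 4 * (e / 16).
    apply: (@flux_le _ _ (u (qv ord0))) => z /cell_cat; apply: HM.
    exact: leq_addl.
  apply: le_trans (ler_normD _ _) _.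
  by have := F ord0 (o l); have := F (o l) ord0; rewrite /=; lra.
have [b0 ble] := bump_nseq k M.+1 pq.
pose w0 (l : 'I_2) := bump k p (nseq (k + M.+1) ord0) (o l).
(* Removing from the bump its values at the two points [q l] leaves a weight whose product with the
   graph Laplacian is 0 at every vertex. *)
pose w s i := bump k p s i - \sum_(l < 2) (pt s i == q l)%:R * w0 l.
have cw : consistent (k + M.+1) w.
  move=> s t i l sm tm E; rewrite /w E; congr (_ - _).
  exact: (@bump_consistent k M.+1 p s t i l sm tm E).
have wD (s : (k + M.+1).-tuple 'I_3) i :
    w s i * graph_laplacian (k + M.+1) u (pt s i) = 0.
  have [[l ql]|nq] := pselect (exists l : 'I_2, pt s i = q l).
    rewrite /w (bigD1 l) //= ql eqxx mul1r big1 => [|l' ll'].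
      rewrite addr0 /w0 -z0E.
      rewrite (@bump_consistent k M.+1 p s (z0 ++ [:: ord0]) i (o l)) //.
      - by rewrite subrr mul0r.
      - by rewrite size_tuple.
      - by rewrite z0E size_nseq.
    case: eqP => [/pt_inj/lift_inj E|]; last by rewrite mul0r.
    by rewrite E eqxx in ll'.
  have -> : w s i = bump k p s i.
    rewrite /w big1 ?subr0 // => l _; case: eqP; last by rewrite mul0r.
    by move=> ql; case: nq; exists l.
  have [->|w0'] := eqVneq (bump k p s i) 0; first by rewrite mul0r.
  rewrite H ?mulr0 // => t i' tm E.
  have bt : bump k p t i' != 0.
    by rewrite (@bump_consistent k M.+1 p t s i' i) ?size_tuple.
  move=> z tz; split.
    have [l lp] := bump_support bt.
    apply: (kW (take k t) l) => //; first by rewrite size_takel ?tm ?leq_addr.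
    by apply: (@cell_cat _ _ (drop k t)); rewrite cat_take_drop.
  move=> zq; rewrite zq in tz; move/cell_q0: tz; rewrite tm => tE.
  rewrite {}tE in E bt; case: (unliftP ord0 i') => [l iE|iE]; last first.
    by rewrite iE b0 eqxx in bt.
  by apply: nq; exists l; rewrite -E /q z0E iE.
have [c [_ cE]] := sum_fibers_flux u cw.
have := bump_flux u k M.+1 p.
under eq_bigr => s _ do under eq_bigr => i _ do
  rewrite -[bump _ _ _ _](subrK (\sum_(l < 2) (pt s i == q l)%:R * w0 l))
    -/(w s i) mulrDl.
under eq_bigr => s _ do rewrite big_split /=.
rewrite big_split /= cE.
rewrite big1 ?add0r; last first.
  by move=> s _; rewrite big1 // => i _; rewrite -mulrA wD mulr0.
under eq_bigr => s _ do under eq_bigr => i _ do rewrite mulr_suml.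
under eq_bigr => s _ do rewrite exchange_big /=.
rewrite exchange_big /= => E.
have {}E : \sum_(l < 2) w0 l * graph_laplacian (k + M.+1) u (q l) =
    (3 / 5) ^+ M.+1 * graph_laplacian k u p.
  rewrite -E; apply: eq_bigr => l _.
  rewrite graph_laplacianE mulr_sumr; apply: eq_bigr => s _.
  by rewrite mulr_sumr; apply: eq_bigr => i _; rewrite mulrCA mulrA.
have q0 : 0 < (3 / 5 : R) ^+ M.+1 by rewrite exprn_gt0 // divr_gt0.
rewrite -(ler_pM2l q0) -[leLHS]ger0_norm; last first.
  by rewrite mulr_ge0 // ltW.
rewrite normrM normr_id -normrM -E.
apply: le_trans (ler_norm_sum _ _ _) _.
apply: (@le_trans _ _ (\sum_(l < 2) (3 / 5) ^+ M.+1 * (e / 2))).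
  apply: ler_sum => l _; rewrite normrM ler_pM //.
  by have /andP[w1 _] := bump_itv k p (nseq (k + M.+1) ord0) (o l);
    rewrite ger0_norm // ble.
by rewrite sumr_const card_ord -mulrnAr -[_ *+ 2]mulr_natr -mulrA mulVf ?mulr1.
Qed.

End Laplacian.

(** * Cells above the line *)

(* [depth s / 2 ^ size s] is the distance from q0 down to the top of the cell s. *)
Definition depth (s : seq 'I_3) : nat :=
  foldl (fun k a => (k.*2 + (a != ord0))%N) 0%N s.

Lemma depth_rcons s a : depth (rcons s a) = ((depth s).*2 + (a != ord0))%N.
Proof. by rewrite /depth -cats1 foldl_cat. Qed.

Lemma depth_coord s : (depth s + bcoord s ord0 + 1 = 2 ^ size s)%N.
Proof.
elim/last_ind: s => [//|s a IH].
by rewrite depth_rcons bcoord_rcons size_rcons expnS -IH; case: (a == ord0); lia.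
Qed.

Lemma depth_cat s t : depth (s ++ t) = (depth s * 2 ^ size t + depth t)%N.
Proof.
elim/last_ind: t => [|t a IH]; first by rewrite cats0 expn0 muln1 addn0.
by rewrite -rcons_cat !depth_rcons IH size_rcons expnS; lia.
Qed.

Lemma depth_lt s : (depth s < 2 ^ size s)%N.
Proof. by have := depth_coord s; lia. Qed.

Lemma depth_nseq k : depth (nseq k ord0) = 0%N.
Proof. by elim: k => // k IH; rewrite nseqSr depth_rcons IH eqxx. Qed.

Lemma depth0 s : (depth s == 0)%N = (s == nseq (size s) ord0).
Proof.
apply/eqP/eqP => [|->]; last exact: depth_nseq.
elim/last_ind: s => [//|s a IH]; rewrite depth_rcons size_rcons nseqSr.
by case: (a =P ord0) => [->|_] /= h; [rewrite -IH //|]; lia.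
Qed.

(* 2 ^ n_m times the m-th partial sum of the binary expansion of x. *)
Fixpoint prefix_num (n : nat -> nat) m : nat :=
  if m is m'.+1 then (prefix_num n m' * 2 ^ (n m - n m') + 1)%N else 0%N.

(* The triangle T_w. *)
Definition topcell (n : nat -> nat) (w : word) : seq 'I_3 :=
  tword n w ++ nseq (n (size w).+1 - n (size w)) ord0.

(** * Position of the cells relative to the line, in terms of the binary digits *)

Section Digits.
Variables (R : realType) (x : R) (n : nat -> nat).
Hypothesis dyad : nondyadic x.
Hypothesis digits : binary_digits x n.

Lemma digit0 : n 0%N = 0%N. Proof. by case: digits. Qed.
Lemma digitS k : (n k < n k.+1)%N. Proof. by case: digits. Qed.

Lemma series_digits m :
  series (fun k => (2 ^- n k.+1 : R)) m = (prefix_num n m)%:R / 2 ^+ n m.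
Proof.
elim: m => [|m IH]; first by rewrite seriesEord /= big_ord0 mul0r.
rewrite seriesSr IH /= natrD natrM natrX mulrDl mul1r; congr (_ + _).
rewrite -{2}(subnK (ltnW (digitS m))) exprD.
by field; rewrite !expf_neq0.
Qed.

(** So [prefix_num n m] is the integer part of 2^(n m) x. The lower bound is strict because a
    further digit follows, the upper one because x is not dyadic. *)
Lemma digit_bounds m :
  (prefix_num n m)%:R < 2 ^+ n m * x < (prefix_num n m)%:R + 1.
Proof.
have [_ _ cv] := digits.
set u := series _ in cv.
have p2 k : 0 < (2 : R) ^+ k by rewrite exprn_gt0.
have uS k : u k.+1 = u k + 2 ^- n k.+1 by rewrite /u seriesSr.
have ux k : u k <= x.
  rewrite -(cvg_lim _ cv) //; apply: nondecreasing_cvgn_le.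
    by apply/nondecreasing_seqP => j; rewrite uS lerDl invr_ge0 ltW.
  by apply/cvg_ex; exists x.
(* The upper approximations [u m + 2 ^- n m] do not increase, as consecutive exponents differ by at
   least 1. *)
have v_le j : u (m + j)%N + 2 ^- n (m + j)%N <= u m + 2 ^- n m.
  elim: j => [|j IH]; first by rewrite addn0.
  apply: le_trans IH; rewrite addnS uS -addrA lerD2l.
  rewrite -(subnK (digitS (m + j))) addnS exprS exprD.
  set d := (_ - _)%N.
  have d1 : 1 <= (2 : R) ^+ d by rewrite exprn_ege1 // ler1n.
  have -> : (2 * (2 ^+ d * 2 ^+ n (m + j)%N))^-1 +
     (2 * (2 ^+ d * 2 ^+ n (m + j)%N))^-1 = 2 ^- n (m + j)%N / 2 ^+ d :> R.
    by field; rewrite !expf_neq0.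
  by rewrite ler_pdivrMr // ler_peMr // invr_ge0 ltW.
have xv : x <= u m + 2 ^- n m.
  rewrite -(cvg_lim _ cv) //; apply: limr_le; first by apply/cvg_ex; exists x.
  exists m => // k /= mk; rewrite -(subnKC mk); apply: le_trans (v_le (k - m)%N).
  by rewrite lerDl invr_ge0 ltW.
have xn : x != u m + 2 ^- n m.
  rewrite /u series_digits -[X in _ + X]div1r -mulrDl natr1.
  exact: (dyad (prefix_num n m).+1%:Z).
have um : u m < x.
  by apply: lt_le_trans (ux m.+1); rewrite uS ltrDl invr_gt0.
move: um; rewrite /u series_digits ltr_pdivrMr // mulrC => -> /=.
have : x < u m + 2 ^- n m by rewrite lt_neqAle xn.
rewrite /u series_digits -[X in _ + X]div1r -mulrDl ltr_pdivlMr //.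
by rewrite mulrC.
Qed.

(** The bottom of the cell is at distance ([depth s] + 1) / 2^(n m) below [q0], to be compared with
    the integer part of 2^(n m) x. *)
Lemma cell_OmegaP s m : size s = n m ->
  (cell s `<=` Omega x) <-> (depth s < prefix_num n m)%N.
Proof.
move=> sm; have /andP[h1 h2] := digit_bounds m.
have p2 : 0 < (2 : R) ^+ n m by rewrite exprn_gt0.
have E : (depth s)%:R + (bcoord s ord0)%:R + 1 = 2 ^+ n m :> R.
  by rewrite -sm -natrX -depth_coord !natrD.
split=> [sO|ds _ [z Sz <-]].
  have [_] := sO _ (cell_pt R s (lift ord0 letter1)).
  rewrite /= -[(pt _ _).2]/(bary ord0 _) bary_pt addn0 sm ltr_pdivlMr // => h.
  rewrite -(ltr_nat R) -(ltrD2r 1); move: h; rewrite /qv /= mulrBl mul1r.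
  rewrite [x * _]mulrC; lra.
split; first exact: SG_Fword.
rewrite /= -[(Fword _ _).2]/(bary ord0 _) bary_Fword sm ltr_pdivlMr //.
have z0 := SG_bary_ge0 ord0 Sz.
move: ds; rewrite -ltnS -(ler_nat R) -natr1 /= => ds; rewrite mulrBl mul1r.
by rewrite [x * _]mulrC; lra.
Qed.

Lemma tword_from_rcons k w i : tword_from n k (rcons w i) =
  tword_from n k w ++
  rcons (nseq (n (k + size w).+1 - n (k + size w)%N - 1) ord0) (lift ord0 i).
Proof.
elim: w k => [|j w IH] k; first by rewrite addn0 /= cats1.
by rewrite /= IH -catA cat_cons addSnnS.
Qed.

Lemma tword_rcons w i : tword n (rcons w i) =
  tword n w ++
  rcons (nseq (n (size w).+1 - n (size w) - 1) ord0) (lift ord0 i).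
Proof. exact: tword_from_rcons. Qed.

Lemma size_tword w : size (tword n w) = n (size w).
Proof.
elim/last_ind: w => [|w i IH]; first by rewrite digit0.
rewrite tword_rcons size_cat !size_rcons size_nseq IH.
by have := digitS (size w); lia.
Qed.

(** By [digit_bounds], this depth means that the line passes strictly between top and bottom of the
    cell; [depth_prefix] is the converse. *)
Lemma depth_tword w : depth (tword n w) = prefix_num n (size w).
Proof.
elim/last_ind: w => [//|w i IH].
rewrite tword_rcons depth_cat IH depth_rcons depth_nseq !size_rcons size_nseq /=.
by rewrite -subSn ?subn_gt0 ?digitS // subn1.
Qed.

Lemma size_topcell w : size (topcell n w) = n (size w).+1.
Proof.
by rewrite size_cat size_tword size_nseq; have := digitS (size w); lia.
Qed.

Lemma topcell_Omega w : cell (topcell n w) `<=` Omega x.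
Proof.
apply/(cell_OmegaP (size_topcell w)).
by rewrite depth_cat depth_tword size_nseq depth_nseq /=; lia.
Qed.

Lemma topcellE w : topcell n w =
  rcons (tword n w ++ nseq (n (size w).+1 - n (size w) - 1) ord0) ord0.
Proof.
rewrite rcons_cat -nseqSr /topcell; congr (_ ++ nseq _ _).
by have := digitS (size w); lia.
Qed.

Lemma pt_topcell0 w : pt (topcell n w) ord0 = pt (tword n w) ord0 :> R * R.
Proof. exact: pt_cat_nseq. Qed.

Lemma pt_topcell w i :
  pt (topcell n w) (lift ord0 i) = pt (tword n (rcons w i)) ord0 :> R * R.
Proof. by rewrite topcellE tword_rcons -rcons_cat pt_rconsC. Qed.

(** Lexicographic comparison in base 2^(n m.+1 - n m): the new digit of [prefix_num] is 1, so it is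
    exceeded only by the digit 0 of a top cell. *)
Lemma depth_split m s v : size v = (n m.+1 - n m)%N ->
  [/\ (depth (s ++ v) < prefix_num n m.+1)%N =
        (depth s < prefix_num n m)%N ||
        (depth s == prefix_num n m) && (depth v == 0%N) &
      (depth (s ++ v) == prefix_num n m.+1) =
        (depth s == prefix_num n m) && (depth v == 1%N)].
Proof.
move=> vN; rewrite depth_cat /= vN; have := depth_lt v; rewrite vN.
have N1 : (1 < 2 ^ (n m.+1 - n m))%N.
  by rewrite -{1}(expn0 2) ltn_exp2l // subn_gt0 digitS.
move: (2 ^ _)%N (depth v) (depth s) (prefix_num n m) N1 => P d e X P1 dP.
have [eX|eX|->] := ltngtP e X.
- have H : (e.+1 * P <= X * P)%N by rewrite leq_pmul2r //; lia.
  rewrite mulSn in H; split => /=; first by lia.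
  by apply/negbTE/eqP; lia.
- have H : (X.+1 * P <= e * P)%N by rewrite leq_pmul2r //; lia.
  rewrite mulSn in H; split => /=; first by apply/negbTE; lia.
  by apply/negbTE/eqP; lia.
- by rewrite /= ltn_add2l eqn_add2l ltnS leqn0.
Qed.

Section Sums.
Variable V : nmodType.
Implicit Type F : seq 'I_3 -> V.

Lemma sum_depth0 k F :
  \sum_(v : k.-tuple 'I_3 | depth v == 0%N) F v = F (nseq k ord0).
Proof.
rewrite (bigD1 [tuple of nseq k ord0]) /=; last by rewrite depth_nseq.
rewrite big1 ?addr0 // => v; rewrite depth0 size_tuple => /andP[/eqP vE].
by rewrite (_ : v = [tuple of nseq k ord0]) ?eqxx //; exact: val_inj.
Qed.

Lemma sum_depth1 k F :
  \sum_(v : k.+1.-tuple 'I_3 | depth v == 1%N) F v =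
  \sum_(i < 2) F (rcons (nseq k ord0) (lift ord0 i)).
Proof.
rewrite big_mkcond.
rewrite (sum_tuple_rcons _ (fun v => if depth v == 1%N then F v else 0)).
transitivity (\sum_(v : k.-tuple 'I_3 | depth v == 0%N)
    \sum_(i < 2) F (rcons v (lift ord0 i))); last first.
  by rewrite (sum_depth0 _ (fun v => \sum_(i < 2) F (rcons v (lift ord0 i)))).
rewrite [RHS]big_mkcond; apply: eq_bigr => v _.
rewrite big_ord_recl depth_rcons eqxx addn0.
rewrite (_ : _.*2 == 1 = false)%N ?add0r; last by apply/eqP; lia.
case: eqP => [d0|d0].
  by apply: eq_bigr => i _; rewrite depth_rcons d0.
by rewrite big1 // => i _; rewrite depth_rcons; case: eqP => //=; lia.
Qed.

Lemma sum_depth_prefix m F :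
  \sum_(s : (n m).-tuple 'I_3 | depth s == prefix_num n m) F s =
  \sum_(w : m.-tuple 'I_2) F (tword n w).
Proof.
elim: m F => [|m IH] F.
  rewrite (sum_tuple0 (fun w => F (tword n w))) big_mkcond digit0.
  by rewrite (sum_tuple0 (fun s => if depth s == prefix_num n 0 then F s else 0)).
rewrite big_mkcond.
rewrite (@sum_tuple_cat _ _ _ (n m) (n m.+1 - n m)
  (fun s => if depth s == prefix_num n m.+1 then F s else 0)); last first.
  by rewrite subnKC // ltnW // digitS.
rewrite (sum_tuple_rcons _ (fun w => F (tword n w))).
pose N := (n m.+1 - n m - 1)%N.
have NE : (n m.+1 - n m)%N = N.+1 by have := digitS m; rewrite /N; lia.
transitivity (\sum_(s : (n m).-tuple 'I_3 | depth s == prefix_num n m)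
    \sum_(i < 2) F (s ++ rcons (nseq N ord0) (lift ord0 i))); last first.
  rewrite (IH (fun s => \sum_(i < 2) F (s ++ rcons (nseq N ord0) (lift ord0 i)))).
  by apply: eq_bigr => w _; apply: eq_bigr => i _; rewrite tword_rcons size_tuple.
rewrite [RHS]big_mkcond; apply: eq_bigr => s _.
rewrite -(sum_depth1 _ (fun v => F (s ++ v))) -NE [X in if _ then X else _]big_mkcond.
case: ifP => ds.
  apply: eq_bigr => v _.
  by have [_ ->] := depth_split s (size_tuple v); rewrite ds.
rewrite big1 // => v _.
by have [_ ->] := depth_split s (size_tuple v); rewrite ds.
Qed.

(** The cells above the line at the next level are the subcells of the old ones and, inside each
    cell crossed by the line, the single triangle at its top. *)
Lemma sum_depth_ltS m F :
  \sum_(s : (n m.+1).-tuple 'I_3 | (depth s < prefix_num n m.+1)%N) F s =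
  \sum_(s : (n m).-tuple 'I_3 | (depth s < prefix_num n m)%N)
    \sum_(v : (n m.+1 - n m).-tuple 'I_3) F (s ++ v) +
  \sum_(w : m.-tuple 'I_2) F (topcell n w).
Proof.
rewrite big_mkcond.
rewrite (@sum_tuple_cat _ _ _ (n m) (n m.+1 - n m)
  (fun s => if (depth s < prefix_num n m.+1)%N then F s else 0)); last first.
  by rewrite subnKC // ltnW // digitS.
transitivity (\sum_(s : (n m).-tuple 'I_3 | (depth s < prefix_num n m)%N)
    \sum_(v : (n m.+1 - n m).-tuple 'I_3) F (s ++ v) +
  \sum_(s : (n m).-tuple 'I_3 | depth s == prefix_num n m)
    F (s ++ nseq (n m.+1 - n m) ord0)); last first.
  congr (_ + _).
  rewrite (sum_depth_prefix _ (fun s => F (s ++ nseq (n m.+1 - n m) ord0))).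
  by apply: eq_bigr => w _; rewrite /topcell size_tuple.
rewrite [X in _ = X + _]big_mkcond [X in _ = _ + X]big_mkcond -big_split /=.
apply: eq_bigr => s _.
rewrite -(sum_depth0 _ (fun v => F (s ++ v))) [X in if _ == _ then X else _]big_mkcond.
case: (ltngtP (depth s)) => ds; rewrite ?addr0 ?add0r; last first.
- apply: eq_bigr => v _.
  by have [-> _] := depth_split s (size_tuple v); rewrite ds ltnn eqxx.
- rewrite big1 // => v _.
  have [-> _] := depth_split s (size_tuple v).
  by rewrite ltnNge ltnW //= gtn_eqF.
- apply: eq_bigr => v _.
  by have [-> _] := depth_split s (size_tuple v); rewrite ds.
Qed.
End Sums.

Lemma depth_prefix m s : size s = n m -> depth s = prefix_num n m ->
  exists2 w, size w = m & s = tword n w.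
Proof.
elim: m s => [|m IH] s sm ds.
  by exists [::] => //; move: sm; rewrite digit0; case: (s).
pose s1 := take (n m) s; pose v := drop (n m) s.
have s1m : size s1 = n m by rewrite size_takel // sm ltnW // digitS.
have vm : size v = (n m.+1 - n m)%N by rewrite size_drop sm.
have [_] := depth_split s1 vm; rewrite cat_take_drop ds eqxx.
move=> /esym/andP[/eqP/(IH _ s1m)[w wm s1E] dv].
move: vm dv (cat_take_drop (n m) s); rewrite -/v -/s1.
have -> : (n m.+1 - n m)%N = (n m.+1 - n m - 1).+1 by have := digitS m; lia.
elim/last_ind: v => [//|v a _]; rewrite size_rcons depth_rcons => -[vm].
case: (unliftP ord0 a) => [i|] ->; last by rewrite eqxx; lia.
move=> dv; have /eqP : depth v == 0%N by move: dv; rewrite /=; lia.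
move/eqP; rewrite depth0 vm => /eqP -> <-.
exists (rcons w i); first by rewrite size_rcons wm.
by rewrite tword_rcons wm s1E.
Qed.

Lemma depth_lt_prefix m s : size s = n m -> (depth s < prefix_num n m)%N ->
  exists w v, (size w < m)%N /\ s = topcell n w ++ v.
Proof.
elim: m s => [|m IH] s sm ds //.
pose s1 := take (n m) s; pose v := drop (n m) s.
have s1m : size s1 = n m by rewrite size_takel // sm ltnW // digitS.
have vm : size v = (n m.+1 - n m)%N by rewrite size_drop sm.
have [+ _] := depth_split s1 vm; rewrite cat_take_drop ds.
move=> /esym/orP[/(IH _ s1m)[w [v' [wm s1E]]]|/andP[/eqP d1]].
  exists w, (v' ++ v); split; first exact: ltnW.
  by rewrite catA -s1E cat_take_drop.
rewrite depth0 vm => /eqP vE.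
have [w wm s1E] := depth_prefix s1m d1.
by exists w, [::]; rewrite wm cats0 /topcell wm -s1E -vE cat_take_drop.
Qed.

Lemma Sw_rcons w i : Sw x n (rcons w i) `<=` (Sw x n w : set (R * R)).
Proof.
by move=> p [Sp cp]; split=> //; move: cp; rewrite tword_rcons; exact: cell_cat.
Qed.

Lemma Line_height_gt0 w (z : R * R) : Line x (Fword (tword n w) z) ->
  0 < bary ord0 z.
Proof.
rewrite /Line /= -[(Fword _ _).2]/(bary ord0 _) bary_Fword size_tword.
have p2 : 2 ^+ n (size w) != 0 :> R by rewrite expf_neq0.
move=> /(congr1 (fun y => y * 2 ^+ n (size w))); rewrite mulfVK // /qv /=.
have E : (prefix_num n (size w))%:R + (bcoord (tword n w) ord0)%:R + 1 =
    2 ^+ n (size w) :> R.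
  by rewrite -depth_tword -[in RHS]size_tword -natrX -depth_coord !natrD.
have /andP[_] := digit_bounds (size w).
rewrite mulrBl mul1r [x * _]mulrC; lra.
Qed.

(** Two sibling cells meet only in a bottom vertex, while the line stays strictly above the bottom
    sides of the cells that it crosses. *)
Lemma Sw_inj w w' (p : R * R) :
  size w = size w' -> Sw x n w p -> Sw x n w' p -> w = w'.
Proof.
elim/last_ind: w w' => [|w i IH] w'; first by case: w'.
elim/last_ind: w' => [|w' i' _]; first by rewrite size_rcons.
rewrite !size_rcons => -[ww'] Sp Sp'.
have E := IH _ ww' (Sw_rcons Sp) (Sw_rcons Sp'); congr rcons => //.
rewrite -{}E {IH ww'} in Sp'.
case: Sp Sp' => -[_ Lp] [z Sz zp] [_ [z' Sz' zp']].
have z0 : 0 < bary ord0 z'.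
  by apply: (@Line_height_gt0 (rcons w i')); rewrite zp'.
move: zp'; rewrite -zp !tword_rcons !Fword_cat => /Fword_inj.
rewrite !Fword_rcons => /Fword_inj /(congr1 (bary (lift ord0 i))).
rewrite !bary_Fi eqxx; case: eqP => [/lift_inj//|_]; rewrite mulr1n mulr0n => H.
have h0 := SG_bary_ge0 (lift ord0 i) Sz.
have h1 := SG_bary_le1 (lift ord0 i) Sz'.
have /(SG_bary1 Sz') z'E : bary (lift ord0 i) z' = 1 by lra.
by move: z0; rewrite z'E bary_qv ltxx.
Qed.

Lemma psi_Sw w w' (p : R * R) : size w' = (size w).+1 -> Sw x n w' p ->
  psi x n w p = Num.sqrt 2 ^+ size w *
    ((w' == rcons w letter1)%:R - (w' == rcons w letter2)%:R).
Proof.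
move=> ww' Sp.
have E i : \1_(Sw x n (rcons w i)) p = (w' == rcons w i)%:R :> R.
  rewrite indicE; congr (nat_of_bool _)%:R; apply/idP/eqP => [|<-].
    by move=> /set_mem; apply: Sw_inj => //; rewrite size_rcons.
  exact/mem_set.
by rewrite /psi !E.
Qed.

End Digits.

(** * Harmonic functions on the binary tree *)

Section Tree.
Variables (R : realType) (rho : nat -> R).
Hypothesis rho_bounds : forall k, 0 < rho k <= 3 / 5.
Implicit Types (g : word -> R) (u v w : word) (i j : 'I_2).

Definition tree_harmonic g : Prop := forall w i,
  rho (size w) * (g w + g (rcons w (rev_ord i)) - 2 * g (rcons w i)) +
  (g (rcons (rcons w i) letter1) + g (rcons (rcons w i) letter2)
   - 2 * g (rcons w i)) = 0.

Definition tree_cvg g (L : word -> R) : Prop := forall e : R, 0 < e ->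
  exists K, forall v, (K <= size v)%N -> `|g v - L v| < e.

Definition mdrop g w : R :=
  g w - (g (rcons w letter1) + g (rcons w letter2)) / 2.

Definition gap g w : R := g (rcons w letter1) - g (rcons w letter2).

Lemma rev_letter1 : rev_ord letter1 = letter2. Proof. exact: val_inj. Qed.
Lemma rev_letter2 : rev_ord letter2 = letter1. Proof. exact: val_inj. Qed.

Lemma tree_harmonicB g g' : tree_harmonic g -> tree_harmonic g' ->
  tree_harmonic (fun w => g w - g' w).
Proof.
move=> hg hg' w i; rewrite -[RHS]subr0 -{1}(hg w i) -(hg' w i); ring.
Qed.

Lemma tree_harmonicN g : tree_harmonic g -> tree_harmonic (fun w => - g w).
Proof. by move=> hg w i; rewrite -[RHS]oppr0 -(hg w i); ring. Qed.

Lemma mdrop_letter1 g w : tree_harmonic g ->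
  mdrop g (rcons w letter1) = rho (size w) / 2 * (mdrop g w - 3 / 2 * gap g w).
Proof. by move=> /(_ w letter1); rewrite rev_letter1 /mdrop /gap; lra. Qed.

Lemma mdrop_letter2 g w : tree_harmonic g ->
  mdrop g (rcons w letter2) = rho (size w) / 2 * (mdrop g w + 3 / 2 * gap g w).
Proof. by move=> /(_ w letter2); rewrite rev_letter2 /mdrop /gap; lra. Qed.

(* From a vertex higher than its parent one can climb for ever. *)
Lemma tree_harmonic_le0 g : tree_harmonic g -> g [::] = 0 ->
  tree_cvg g (fun=> 0) -> forall w, g w <= 0.
Proof.
move=> hg g0 lim w; rewrite leNgt; apply/negP => gw.
(* The flux balance at a vertex involves its sibling, so the climb always goes through the larger of
   the two. *)
have sibling u i : g u < g (rcons u i) -> 0 < g (rcons u i) ->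
    exists2 j, g u < g (rcons u j) & 
      g (rcons u (rev_ord j)) <= g (rcons u j) /\ g (rcons u i) <= g (rcons u j).
  move=> gi gi0; have [le|lt] := leP (g (rcons u (rev_ord i))) (g (rcons u i)).
    by exists i.
  by exists (rev_ord i); rewrite ?rev_ordK ?(ltW lt) //; exact: lt_trans lt.
have [u [i [gu gi]]] : exists u i, g u < g (rcons u i) /\ 0 < g (rcons u i).
  elim/last_ind: w gw => [|w i IH] gw; first by rewrite g0 ltxx in gw.
  have [gw0|/IH//] := leP (g w) 0.
  by exists w, i; split => //; exact: le_lt_trans gw.
have climb d : exists v j, [/\ (d <= size v)%N, g v < g (rcons v j),
    g (rcons v (rev_ord j)) <= g (rcons v j) & g (rcons u i) <= g (rcons v j)].
  elim: d => [|d [v [j [dv vj rj ij]]]].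
    by have [j ? []] := sibling _ _ gu gi; exists u, j.
  have /andP[r0 _] := rho_bounds (size v).
  (* Seen from the larger sibling, the parent is strictly lower and the other sibling not higher;
     the balance then forces a higher child. *)
  have [k hk] : exists k, g (rcons v j) < g (rcons (rcons v j) k).
    have E := hg v j.
    have E0 : 0 < rho (size v) * (2 * g (rcons v j) - g v - g (rcons v (rev_ord j))).
      by apply: mulr_gt0 => //; lra.
    have [h1|h1] := ltP (g (rcons v j)) (g (rcons (rcons v j) letter1)).
      by exists letter1.
    have [h2|h2] := ltP (g (rcons v j)) (g (rcons (rcons v j) letter2)).
      by exists letter2.
    by exfalso; lra.
  have hk0 : 0 < g (rcons (rcons v j) k).
    by apply: lt_trans hk; exact: lt_le_trans ij.
  have [l vl [rl kl]] := sibling _ _ hk hk0.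
  exists (rcons v j), l; split => //; first by rewrite size_rcons.
  by apply: (le_trans ij); apply: ltW; exact: lt_le_trans kl.
have [K HK] := lim _ gi; have [v [j [Kv _ _ ij]]] := climb K.
have := HK (rcons v j); rewrite size_rcons subr0 => /(_ (leqW Kv)).
by rewrite ltNge (le_trans ij) // ler_norm.
Qed.

Lemma tree_harmonic_eq0 g : tree_harmonic g -> g [::] = 0 ->
  tree_cvg g (fun=> 0) -> forall w, g w = 0.
Proof.
move=> hg g0 lim w; apply/eqP; rewrite eq_le (tree_harmonic_le0 hg) //=.
rewrite -oppr_le0.
apply: (tree_harmonic_le0 (tree_harmonicN hg)); first by rewrite g0 oppr0.
move=> e /lim[K HK]; exists K => v /HK; by rewrite !subr0 normrN.
Qed.

(* The automorphism of the tree that exchanges the two subtrees below u. *)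
Fixpoint swap u v : word :=
  if v is b :: v' then
    if u is a :: u' then b :: (if a == b then swap u' v' else v')
    else rev_ord b :: v'
  else [::].

Lemma size_swap u v : size (swap u v) = size v.
Proof.
by elim: u v => [|a u IH] [|b v] //=; case: ifP => //= _; rewrite IH.
Qed.

Lemma swap_rcons u v i :
  swap u (rcons v i) = rcons (swap u v) (if u == v then rev_ord i else i).
Proof.
elim: u v => [|a u IH] [|b v] //=.
  by case: (a == i); case: u {IH}.
rewrite eqseq_cons; case: ifP => //= _.
by rewrite IH.
Qed.

Lemma take_swap K u v : take K (swap u v) = swap u (take K v).
Proof.
elim: u K v => [|a u IH] [|K] [|b v] //=.
by congr cons; case: ifP.
Qed.

Lemma swap_id u v : (size v <= size u)%N -> swap u v = v.
Proof.
elim: u v => [|a u IH] [|b v] //= vu.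
by rewrite IH // if_same.
Qed.

Lemma tree_harmonic_swap u g : tree_harmonic g ->
  tree_harmonic (fun v => g (swap u v)).
Proof.
move=> hg w i; rewrite !swap_rcons -(size_swap u w).
have := hg (swap u w) (if u == w then rev_ord i else i).
case: ifP => uw; rewrite ?rev_ordK;
  case: ifP => uwi; rewrite ?rev_letter1 ?rev_letter2 => H //; rewrite -[RHS]H; ring.
Qed.

Lemma tree_cvg_swap u g K (L : word -> R) :
  tree_cvg g (fun v => L (take K v)) ->
  tree_cvg (fun v => g (swap u v)) (fun v => L (swap u (take K v))).
Proof.
move=> lim e /lim[N HN]; exists N => v Nv.
by rewrite -take_swap; apply: HN; rewrite size_swap.
Qed.

Lemma tree_cvgB g g' (L L' : word -> R) : tree_cvg g L -> tree_cvg g' L' ->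
  (forall v, L v - L' v = 0) -> tree_cvg (fun v => g v - g' v) (fun=> 0).
Proof.
move=> lim lim' LL e e0; have e2 : 0 < e / 2 by rewrite divr_gt0.
have [N HN] := lim _ e2; have [N' HN'] := lim' _ e2.
exists (maxn N N') => v; rewrite geq_max => /andP[/HN h /HN' h'].
have -> : g v - g' v - 0 = (g v - L v) - (g' v - L' v) by have := LL v; lra.
by apply: le_lt_trans (ler_normB _ _) _; lra.
Qed.

(** [t] is a function along a branch and [e] its successive drops: t 0 - L is the sum of the e k,
    and 10/7 = 1/(1 - 3/10) bounds the geometric series. *)
Lemma geometric_sum_le (t e r : nat -> R) (L : R) :
  (forall k, t k.+1 = t k - e k) -> (forall k, e k.+1 = r k * e k) ->
  (forall k, 0 <= r k <= 3 / 10) -> 0 <= e 0%N ->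
  (forall d : R, 0 < d -> exists K, forall k, (K <= k)%N -> `|t k - L| < d) ->
  e 0%N <= t 0%N - L <= 10 / 7 * e 0%N.
Proof.
move=> tS eS rb e0 lim.
have ek k : 0 <= e k.
  by elim: k => // k IH; rewrite eS mulr_ge0 //; case/andP: (rb k).
have ub k : t k.+1 <= t 0%N - e 0%N.
  by elim: k => [|k IH]; rewrite tS //; have := ek k.+1; lra.
(* [t k - 10 / 7 * e k] does not decrease, since 1 + 10/7 * 3/10 = 10/7. *)
have lb k : t 0%N - 10 / 7 * e 0%N <= t k - 10 / 7 * e k.
  elim: k => // k IH; rewrite tS eS; apply: (le_trans IH).
  have /andP[r0 r3] := rb k.
  have : r k * e k <= 3 / 10 * e k by rewrite ler_wpM2r.
  lra.
apply/andP; split; rewrite leNgt; apply/negP => h.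
- have h2 : 0 < e 0%N - (t 0%N - L) by lra.
  have [K HK] := lim _ h2.
  have := HK K.+1 (leqnSn K); rewrite ltr_norml; have := ub K; lra.
- have h2 : 0 < t 0%N - L - 10 / 7 * e 0%N by lra.
  have [K HK] := lim _ h2.
  have := HK K (leqnn K); rewrite ltr_norml; have := lb K; have := ek K; lra.
Qed.

End Tree.

(** * Harmonic functions above the line *)

Section Regular.
Variables (R : realType).
Implicit Types (u : R * R -> R) (s : seq 'I_3) (a b : 'I_3).

(** The three midpoint equations force the 2/5, 2/5, 1/5 rule; thus (5/3)^m times the flux at a
    fixed corner does not depend on the level m. *)
Lemma flux_corner u s a :
  (forall a b, a != b -> flux u (rcons s a) b + flux u (rcons s b) a = 0) ->
  flux u (rcons s a) a = 3 / 5 * flux u s a.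
Proof.
move=> H.
have := H ord0 (lift ord0 letter1) isT.
have := H ord0 (lift ord0 letter2) isT.
have := H (lift ord0 letter1) (lift ord0 letter2) isT.
rewrite !fluxE !big_ord3.
elim/ord3P: a; rewrite !pt_rcons (pt_rconsC _ s (lift ord0 letter1) ord0)
  (pt_rconsC _ s (lift ord0 letter2) ord0)
  (pt_rconsC _ s (lift ord0 letter2) (lift ord0 letter1)); lra.
Qed.

Lemma cell_energyE u s : cell_energy u s =
  (u (pt s ord0) - u (pt s (lift ord0 letter1))) ^+ 2 +
  (u (pt s ord0) - u (pt s (lift ord0 letter2))) ^+ 2 +
  (u (pt s (lift ord0 letter1)) - u (pt s (lift ord0 letter2))) ^+ 2.
Proof.
rewrite /cell_energy big_ord3 !(big_mkcond (fun j => _ < _)%N) !big_ord3 /=.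
by rewrite -!/(pt _ _) !add0r !addr0.
Qed.

Lemma cell_energy_refine u s :
  (forall a b, a != b -> flux u (rcons s a) b + flux u (rcons s b) a = 0) ->
  \sum_(a < 3) cell_energy u (rcons s a) = 3 / 5 * cell_energy u s.
Proof.
move=> H.
have := H ord0 (lift ord0 letter1) isT.
have := H ord0 (lift ord0 letter2) isT.
have := H (lift ord0 letter1) (lift ord0 letter2) isT.
rewrite !fluxE !big_ord3 !cell_energyE !pt_rcons.
rewrite (pt_rconsC _ s (lift ord0 letter1) ord0)
  (pt_rconsC _ s (lift ord0 letter2) ord0)
  (pt_rconsC _ s (lift ord0 letter2) (lift ord0 letter1)).
set x0 := u (pt s ord0); set x1 := u (pt s (lift ord0 letter1)).
set x2 := u (pt s (lift ord0 letter2)).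
set y01 := u (pt (rcons s ord0) (lift ord0 letter1)).
set y02 := u (pt (rcons s ord0) (lift ord0 letter2)).
set y12 := u (pt (rcons s (lift ord0 letter1)) (lift ord0 letter2)).
move=> e12 e02 e01.
have -> : y01 = (2 * x0 + 2 * x1 + x2) / 5 by lra.
have -> : y02 = (2 * x0 + 2 * x2 + x1) / 5 by lra.
have -> : y12 = (2 * x1 + 2 * x2 + x0) / 5 by lra.
by field.
Qed.

Lemma midpoint0 u s :
  (forall a b, a != b -> flux u (rcons s a) b + flux u (rcons s b) a = 0) ->
  (forall i, u (pt s i) = 0) -> forall a i, u (pt (rcons s a) i) = 0.
Proof.
move=> H z a i.
have := H ord0 (lift ord0 letter1) isT.
have := H ord0 (lift ord0 letter2) isT.
have := H (lift ord0 letter1) (lift ord0 letter2) isT.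
rewrite !fluxE !big_ord3.
elim/ord3P: a; elim/ord3P: i; rewrite !pt_rcons
  (pt_rconsC _ s (lift ord0 letter1) ord0)
  (pt_rconsC _ s (lift ord0 letter2) ord0)
  (pt_rconsC _ s (lift ord0 letter2) (lift ord0 letter1)) !z; lra.
Qed.

Section Cells.
Variable W : set (R * R).

Definition cell_harmonic u : Prop := forall s, cell s `<=` W ->
  forall a b, a != b -> flux u (rcons s a) b + flux u (rcons s b) a = 0.

Lemma flux_nseq u s a k : cell_harmonic u -> cell s `<=` W ->
  flux u (s ++ nseq k a) a = (3 / 5) ^+ k * flux u s a.
Proof.
move=> hu sW; elim: k => [|k IH]; first by rewrite cats0 expr0 mul1r.
rewrite nseqSr -rcons_cat flux_corner; last first.
  by apply: hu => z /cell_cat; exact: sW.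
by rewrite IH exprS mulrA.
Qed.

Lemma cell_energy_cat u s k : cell_harmonic u -> cell s `<=` W ->
  \sum_(v : k.-tuple 'I_3) cell_energy u (s ++ v) =
  (3 / 5) ^+ k * cell_energy u s.
Proof.
move=> hu sW; elim: k => [|k IH].
  by rewrite (sum_tuple0 (fun v => cell_energy u (s ++ v))) cats0 expr0 mul1r.
rewrite (sum_tuple_rcons _ (fun v => cell_energy u (s ++ v))).
rewrite exprS -mulrA -IH mulr_sumr; apply: eq_bigr => v _.
rewrite -cell_energy_refine; last first.
  by apply: hu => z /cell_cat; exact: sW.
by apply: eq_bigr => a _; rewrite rcons_cat.
Qed.

Lemma cell_harmonic0 u s : cell_harmonic u -> cell s `<=` W ->
  (forall i, u (pt s i) = 0) -> forall v i, u (pt (s ++ v) i) = 0.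
Proof.
move=> hu sW z; elim/last_ind => [|v a IH] i; first by rewrite cats0.
rewrite -rcons_cat; apply: midpoint0 => //.
by apply: hu => q /cell_cat; exact: sW.
Qed.
End Cells.
End Regular.

(** * From harmonic functions with boundary values to functions on the tree *)

Section Boundary.
Variables (R : realType) (x : R) (n : nat -> nat).
Hypothesis dyad : nondyadic x.
Hypothesis digits : binary_digits x n.
Implicit Types (u : R * R -> R) (w v : word) (i : 'I_2).

Definition weight (k : nat) : R := (3 / 5) ^+ (n k.+2 - n k.+1).

Lemma weight_bounds k : 0 < weight k <= 3 / 5.
Proof.
rewrite /weight exprn_gt0 ?divr_gt0 //=.
have : (0 < n k.+2 - n k.+1)%N by rewrite subn_gt0 (digitS digits).
case: (n k.+2 - n k.+1)%N => // d _; rewrite exprS ler_piMr //.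
by rewrite exprn_ile1 //; lra.
Qed.

Definition vertex_val u w : R := u (pt (tword n w) ord0).

(** The cell T_w is subdivided towards the vertex v_wi down to the level of T_wi, so that the two
    cells meeting there have equal size. *)
Definition junction_harmonic u : Prop := forall w i,
  flux u (topcell n w ++ nseq (n (size w).+2 - n (size w).+1) (lift ord0 i))
    (lift ord0 i) +
  flux u (topcell n (rcons w i)) ord0 = 0.

Lemma vertex_val_harmonic u : cell_harmonic (Omega x) u ->
  junction_harmonic u -> tree_harmonic weight (vertex_val u).
Proof.
move=> hu ju w i; have := ju w i.
rewrite (flux_nseq _ _ hu (@topcell_Omega _ _ _ dyad digits w)) -/(weight _).
rewrite !fluxE !big_ord3 !pt_topcell0 !(pt_topcell digits) -!/(vertex_val _ _).
by move=> H; rewrite -[RHS]H; elim/ord2P: i {H};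
  rewrite ?rev_letter1 ?rev_letter2; ring.
Qed.

Lemma pt_neq_q0 s j : j != ord0 -> pt s j != qv ord0 :> R * R.
Proof.
move=> j0; apply/eqP => /(congr1 (bary ord0)); rewrite bary_pt bary_qv eqxx.
rewrite (negPf j0) addn0 => /(divr1_eq); apply/eqP.
by rewrite -natrX eqr_nat -(depth_coord s); lia.
Qed.

Section Harmonic.
Variables (a : R) (bd : R * R -> R) (u : R * R -> R).
Hypothesis hu : harmonic_with_boundary x a bd u.

Lemma height_sub_Omega s : cell s `&` [set p | 1 - x <= p.2] `<=`
  Omega x `|` Sx x.
Proof.
move=> p [/cell_SG Sp /=]; rewrite le_eqVlt => /predU1P[E|lt]; [right|left].
  by split=> //; rewrite /Line /= -E.
by split.
Qed.

Lemma le_digit k : (k <= n k)%N.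
Proof. by elim: k => // k /leq_ltn_trans; apply; exact: (digitS digits). Qed.

Lemma small_pow2 (d : R) : 0 < d ->
  exists M, forall m, (M <= m)%N -> (2 ^+ m)^-1 < d.
Proof.
move=> d0; exists (Num.bound d^-1) => m /upper_nthrootP.
by rewrite -invf_plt ?posrE ?exprn_gt0 // => /lt_le_trans; apply.
Qed.

Lemma harmonic_cont_q0 (e : R) : 0 < e -> exists M, forall m, (M <= m)%N ->
  forall z, cell (nseq m ord0) z -> `|u z - u (qv ord0)| < e.
Proof.
case: hu => _ uc _ _ e0.
have Bq p : (cell [::] `&` [set p : R * R | 1 - x <= p.2]) p -> p.2 = 1 ->
    u p = u (qv ord0).
  by move=> [/cell_SG Sp _] p1; rewrite (@SG_bary1 _ ord0 _ Sp p1).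
have [d d0 Hd] := within_height_cvg uc (@height_compact R [::] (1 - x))
  (@height_sub_Omega [::]) Bq e0.
have /andP[x0 _] := digit_bounds dyad digits 0.
rewrite (digit0 digits) expr0 mul1r /= in x0.
(* The bound [d] keeps the cell within the range of uniformity, the bound [x] keeps it above the
   line. *)
have dx0 : 0 < Num.min d x by rewrite lt_min d0.
have [M HM] := small_pow2 dx0.
exists M => m /HM; rewrite lt_min => /andP[md mx] z zc.
have z1 : z.2 <= 1 := SG_bary_le1 ord0 (cell_SG zc).
have z2 : 1 - (2 ^+ m)^-1 <= z.2.
  case: zc => z' Sz' <-; rewrite -[leRHS]/(bary ord0 _) bary_Fword size_nseq.
  have p2 : 0 < (2 : R) ^+ m by rewrite exprn_gt0.
  rewrite ler_pdivlMr // mulrBl mulVf ?lt0r_neq0 // mul1r.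
  have := depth_coord (nseq m ord0); rewrite depth_nseq size_nseq add0n => E.
  by rewrite -natrX -E natrD addrK lerDl; exact: SG_bary_ge0.
apply: Hd; last by rewrite ltr_norml; lra.
split; last by rewrite /=; lra.
by exists z => //; exact: cell_SG zc.
Qed.

Lemma harmonic_vertex k (p : R * R) : p != qv ord0 ->
  (forall s (j : 'I_3), size s = k -> pt s j = p -> cell s `<=` Omega x) ->
  graph_laplacian k u p = 0.
Proof.
case: hu => uh _ _ _; apply: removable_vertex harmonic_cont_q0 _ => m q.
exact: has_laplacian0_vertex uh.
Qed.

Lemma harmonic_junction (r : seq 'I_3) (a' b : 'I_3) k : a' != b ->
  cell (r ++ a' :: nseq k b) `<=` Omega x ->
  cell (r ++ b :: nseq k a') `<=` Omega x ->
  flux u (r ++ a' :: nseq k b) b + flux u (r ++ b :: nseq k a') a' = 0.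
Proof.
move=> ab aO bO; rewrite -(laplacian_junction _ ab (erefl _)).
apply: harmonic_vertex => [|s j ss E].
  have [b0|] := eqVneq b ord0; last exact: pt_neq_q0.
  by rewrite pt_junctionC; apply: pt_neq_q0; rewrite -b0.
by case: (pt_junction ab ss (esym E)) => -[->].
Qed.

Lemma harmonic_cell : cell_harmonic (Omega x) u.
Proof.
move=> s sO a' b ab; rewrite -!cats1.
by apply: (@harmonic_junction s a' b 0 ab) => z /cell_cat; exact: sO.
Qed.

Lemma harmonic_top : junction_harmonic u.
Proof.
move=> w i; pose r := tword n w ++ nseq (n (size w).+1 - n (size w) - 1) ord0.
have E1 k : topcell n w ++ nseq k (lift ord0 i) =
    r ++ ord0 :: nseq k (lift ord0 i).
  by rewrite (topcellE digits) cat_rcons.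
have E2 : topcell n (rcons w i) =
    r ++ lift ord0 i :: nseq (n (size w).+2 - n (size w).+1) ord0.
  by rewrite /topcell tword_rcons size_rcons -cat_rcons /r rcons_cat.
rewrite E1 E2; apply: harmonic_junction => //.
  by rewrite -E1 => z /cell_cat; exact: topcell_Omega.
by rewrite -E2; exact: topcell_Omega.
Qed.

Lemma tword_from_cat k w v :
  tword_from n k (w ++ v) = tword_from n k w ++ tword_from n (k + size w) v.
Proof.
elim: w k => [|i w IH] k /=; first by rewrite addn0.
by rewrite IH -catA cat_cons addSnnS.
Qed.

(** The top of Ftilde_v lies within 2^-(n |v|) of the line in height, inside the compact part of
    Ftilde_w above the line. *)
Lemma vertex_val_cvg w (c e : R) : (forall p, Sw x n w p -> u p = c) -> 0 < e ->
  exists K, forall v, (K <= size v)%N -> take (size w) v = w ->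
    `|vertex_val u v - c| < e.
Proof.
case: hu => _ uc _ _ uw e0.
have Bw p : (cell (tword n w) `&` [set p : R * R | 1 - x <= p.2]) p ->
    p.2 = 1 - x -> u p = c.
  by move=> [wp _] px; apply: uw; split=> //; split=> //; exact: cell_SG wp.
have [d d0 Hd] := within_height_cvg uc (@height_compact R (tword n w) (1 - x))
  (@height_sub_Omega _) Bw e0.
have [K HK] := small_pow2 d0.
exists K => v Kv vw.
have vcell : cell (tword n w) (pt (tword n v) ord0 : R * R).
  rewrite -(cat_take_drop (size w) v) vw /tword tword_from_cat.
  exact: cell_cat (cell_pt _ _ _).
have /andP[b1 b2] := digit_bounds dyad digits (size v).
have p2 : 0 < (2 : R) ^+ n (size v) by rewrite exprn_gt0.
have hE : (pt (tword n v) ord0 : R * R).2 =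
    1 - (prefix_num n (size v))%:R / 2 ^+ n (size v).
  rewrite -[LHS]/(bary ord0 _) bary_pt (size_tword digits) eqxx.
  apply: (mulIf (lt0r_neq0 p2)); rewrite mulrBl !mulfVK ?lt0r_neq0 // mul1r.
  rewrite -(depth_tword digits v) -[in RHS](size_tword digits v) -natrX.
  by rewrite -depth_coord !natrD /=; ring.
have h1 : (prefix_num n (size v))%:R / 2 ^+ n (size v) < x.
  by rewrite ltr_pdivrMr // mulrC.
have h2 : x < (prefix_num n (size v))%:R / 2 ^+ n (size v) + d.
  apply: (@lt_trans _ _ ((prefix_num n (size v))%:R / 2 ^+ n (size v) +
     (2 ^+ n (size v))^-1)).
    by rewrite -[X in _ + X]div1r -mulrDl ltr_pdivlMr // mulrC.
  rewrite ltrD2l; apply: HK; apply: leq_trans Kv _; exact: le_digit.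
apply: Hd; first by split => //=; rewrite hE; lra.
by rewrite hE ltr_norml; lra.
Qed.

Lemma vertex_val_tree_cvg k (L : word -> R) :
  (forall w, size w = k -> forall p, Sw x n w p -> u p = L w) ->
  tree_cvg (vertex_val u) (fun v => L (take k v)).
Proof.
move=> uL e e0.
have H (w : k.-tuple 'I_2) : exists K, forall v, (K <= size v)%N ->
    take k v = w -> `|vertex_val u v - L w| < e.
  have [K HK] := vertex_val_cvg (uL w (size_tuple w)) e0.
  by exists K => v Kv vw; apply: HK; rewrite ?size_tuple.
have [N HN] := choice H.
exists (maxn k (\max_w N w)) => v; rewrite geq_max => /andP[kv Nv].
have tk : size (take k v) == k by rewrite size_takel.
apply: (HN (Tuple tk)) => //; apply: leq_trans Nv.
exact: (leq_bigmax (Tuple tk)).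
Qed.
End Harmonic.
End Boundary.

(** * The functions h0 and h_w *)

Section Basis.
Variables (R : realType) (x : R) (n : nat -> nat).
Hypothesis dyad : nondyadic x.
Hypothesis digits : binary_digits x n.
Implicit Types (g : word -> R) (u v w : word).

Local Notation rho := (weight R n).

(** Where gaps vanish siblings have equal values, so the leftmost branch represents the whole
    subtree. *)
Lemma gap0_leftmost g w k : tree_harmonic rho g ->
  (forall u, (size w <= size u)%N -> gap g u = 0) ->
  let p k := w ++ nseq k letter1 in
  g (p k.+1) = g (p k) - mdrop g (p k) /\
  mdrop g (p k.+1) = rho (size w + k) / 2 * mdrop g (p k).
Proof.
move=> hg g0 p; rewrite {}/p.
have gk : gap g (w ++ nseq k letter1) = 0.
  by apply: g0; rewrite size_cat leq_addr.
rewrite nseqSr -rcons_cat; split.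
  by move: gk; rewrite /gap /mdrop; lra.
by rewrite (mdrop_letter1 _ hg) gk mulr0 subr0 size_cat size_nseq.
Qed.

Lemma leftmost_bounds g w (L : R) : tree_harmonic rho g ->
  (forall u, (size w <= size u)%N -> gap g u = 0) ->
  (forall d : R, 0 < d ->
     exists K, forall k, (K <= k)%N -> `|g (w ++ nseq k letter1) - L| < d) ->
  0 <= mdrop g w -> mdrop g w <= g w - L <= 10 / 7 * mdrop g w.
Proof.
move=> hg g0 lim m0.
have := @geometric_sum_le R (fun k => g (w ++ nseq k letter1))
  (fun k => mdrop g (w ++ nseq k letter1)) (fun k => rho (size w + k) / 2) L.
rewrite cats0; apply=> // k.
- by have [] := gap0_leftmost k hg g0.
- by have [] := gap0_leftmost k hg g0.
- by have := weight_bounds digits (size w + k); lra.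
Qed.

Lemma leftmost_bounds_neg g w (L : R) : tree_harmonic rho g ->
  (forall u, (size w <= size u)%N -> gap g u = 0) ->
  (forall d : R, 0 < d ->
     exists K, forall k, (K <= k)%N -> `|g (w ++ nseq k letter1) - L| < d) ->
  mdrop g w <= 0 -> 10 / 7 * mdrop g w <= g w - L <= mdrop g w.
Proof.
move=> hg g0 lim m0.
have E : mdrop (fun v => - g v) w = - mdrop g w by rewrite /mdrop; ring.
have := @leftmost_bounds (fun v => - g v) w (- L) (tree_harmonicN hg).
rewrite E => H; suff: - mdrop g w <= - g w - - L <= 10 / 7 * - mdrop g w by lra.
apply: H; last by lra.
  by move=> u /g0; rewrite /gap; lra.
move=> d /lim[K HK]; exists K => k /HK; by rewrite -opprD normrN.
Qed.

(** Uniqueness applied to g o swap - g, which is 0 at the root because a swap fixes it. *)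
Lemma swap_symmetric g u k (L : word -> R) : tree_harmonic rho g ->
  tree_cvg g (fun v => L (take k v)) ->
  (forall v, (size v <= k)%N -> L (swap u v) = L v) ->
  forall v, g (swap u v) = g v.
Proof.
move=> hg lim LE v; apply/eqP; rewrite -subr_eq0; apply/eqP.
apply: (tree_harmonic_eq0 (weight_bounds digits)
  (g := fun v => g (swap u v) - g v)).
- by apply: tree_harmonicB => //; exact: tree_harmonic_swap.
- by rewrite swap_id // subrr.
- apply: tree_cvgB (tree_cvg_swap u lim) lim _ => v'.
  by rewrite LE ?subrr // size_take_min geq_minl.
Qed.

Lemma swap_antisymmetric g u k (L : word -> R) : tree_harmonic rho g ->
  g [::] = 0 ->
  tree_cvg g (fun v => L (take k v)) ->
  (forall v, (size v <= k)%N -> L (swap u v) = - L v) ->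
  forall v, g (swap u v) = - g v.
Proof.
move=> hg g0 lim LE v; apply/eqP; rewrite -subr_eq0; apply/eqP.
apply: (tree_harmonic_eq0 (weight_bounds digits)
  (g := fun v => g (swap u v) - - g v)).
- apply: tree_harmonicB; first exact: tree_harmonic_swap.
  exact: tree_harmonicN.
- by rewrite swap_id // g0; lra.
- have limN : tree_cvg (fun v => - g v) (fun v => - L (take k v)).
    by move=> e /lim[K HK]; exists K => v' /HK; rewrite -opprD normrN.
  apply: tree_cvgB (tree_cvg_swap u lim) limN _ => v'.
  by rewrite LE ?subrr // size_take_min geq_minl.
Qed.

Lemma gap_symmetric g u : (forall v, g (swap u v) = g v) -> gap g u = 0.
Proof.
move=> H; rewrite /gap -(H (rcons u letter1)) swap_rcons eqxx rev_letter1.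
by rewrite swap_id // subrr.
Qed.

Section H0.
Variable h0 : R * R -> R.
Hypothesis hh0 : harmonic_with_boundary x 1 (fun=> 0) h0.
Local Notation g := (vertex_val n h0).

Lemma h0_harmonic : tree_harmonic rho g.
Proof.
apply: (vertex_val_harmonic dyad digits).
  exact: (harmonic_cell dyad digits hh0).
exact: (harmonic_top dyad digits hh0).
Qed.

Lemma h0_cvg : tree_cvg g (fun v => (fun=> 0) (take 0 v)).
Proof.
apply: (vertex_val_tree_cvg dyad digits hh0) => w _ p [Sp _].
by case: hh0 => _ _ _; apply; exact/mem_set.
Qed.

Lemma h0_gap u : gap g u = 0.
Proof.
apply: gap_symmetric; apply: (swap_symmetric h0_harmonic h0_cvg) => //.
Qed.

(** The total fall from [q0] to the line is 1, whence M_0 <= 1 <= (10/7) M_0; a negative M_0 would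
    make the fall negative. *)
Lemma h0_mdrop : 7 / 10 <= mdrop g [::] <= 1.
Proof.
have lim (d : R) : 0 < d ->
    exists K, forall k, (K <= k)%N -> `|g ([::] ++ nseq k letter1) - 0| < d.
  by move=> /h0_cvg[K HK]; exists K => k Kk; apply: HK; rewrite size_nseq.
have g1 : g [::] = 1 by case: hh0.
have g0 u : (size ([::] : word) <= size u)%N -> gap g u = 0 by rewrite h0_gap.
have [m0|m0] := leP 0 (mdrop g [::]).
  by have := leftmost_bounds h0_harmonic g0 lim m0; rewrite g1; lra.
by have := leftmost_bounds_neg h0_harmonic g0 lim (ltW m0); rewrite g1; lra.
Qed.
End H0.

Section Hw.
Variables (w : word) (hw : R * R -> R).
Hypothesis hhw : harmonic_with_boundary x 0 (psi x n w) hw.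
Local Notation g := (vertex_val n hw).

Lemma hw_harmonic : tree_harmonic rho g.
Proof.
apply: (vertex_val_harmonic dyad digits).
  exact: (harmonic_cell dyad digits hhw).
exact: (harmonic_top dyad digits hhw).
Qed.

Let L v : R := Num.sqrt 2 ^+ size w *
  ((v == rcons w letter1)%:R - (v == rcons w letter2)%:R).

Lemma hw_cvg : tree_cvg g (fun v => L (take (size w).+1 v)).
Proof.
apply: (vertex_val_tree_cvg dyad digits hhw) => w' ww' p wp.
rewrite /L -(psi_Sw dyad digits ww' wp).
by case: wp => Sp _; case: hhw => _ _ _; apply; exact/mem_set.
Qed.

Lemma hw_nil : g [::] = 0. Proof. by case: hhw. Qed.

Lemma hw_antisymmetric v : g (swap w v) = - g v.
Proof.
apply: (swap_antisymmetric hw_harmonic hw_nil hw_cvg) => v'.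
rewrite /L -mulrN opprB; case: (lastP v') => [_|v1 i].
  by rewrite swap_id //; case: (w).
rewrite size_rcons ltnS => v1w; rewrite swap_rcons (swap_id v1w) !eqseq_rcons.
rewrite [w == v1]eq_sym; congr (_ * _); case: eqP => //= _.
by elim/ord2P: i; rewrite ?rev_letter1 ?rev_letter2.
Qed.

Lemma hw_eq0 v : (size v <= size w)%N -> g v = 0.
Proof.
by move=> vw; have := hw_antisymmetric v; rewrite swap_id //; lra.
Qed.

(** A swap at a word longer than [w] preserves the boundary values. For any other u, the swap at [w]
    fixes both children of [u], where antisymmetry then gives 0. *)
Lemma hw_gap0 u : u != w -> gap g u = 0.
Proof.
move=> uw; have [wu|wu] := ltnP (size w) (size u).
  apply: gap_symmetric; apply: (swap_symmetric hw_harmonic hw_cvg) => v vw.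
  by rewrite swap_id // (leq_trans vw).
have Z i : g (rcons u i) = 0.
  have := hw_antisymmetric (rcons u i).
  by rewrite swap_rcons swap_id // eq_sym (negPf uw); lra.
by rewrite /gap !Z subrr.
Qed.

Lemma hw_mdrop_nil : mdrop g [::] = 0.
Proof.
rewrite /mdrop hw_nil; case: (posnP (size w)) => [/size0nil w0|w0].
  have := hw_antisymmetric [:: letter1].
  by rewrite w0 /= rev_letter1 /=; lra.
by rewrite !hw_eq0 //= addr0 mul0r subrr.
Qed.

(** Put b = g(w1) and s = 2^(|w|/2). The drop at w1 is -(3/2) rho b, so b - s lies between -(15/7)
    rho b and -(3/2) rho b; with rho <= 3/5 this gives (7/16) s <= b <= s, and the gap is 2b. *)
Lemma hw_gap : 7 / 8 * Num.sqrt 2 ^+ size w <= gap g w <= 2 * Num.sqrt 2 ^+ size w.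
Proof.
have lim (d : R) : 0 < d -> exists K, forall k, (K <= k)%N ->
    `|g (rcons w letter1 ++ nseq k letter1) - Num.sqrt 2 ^+ size w| < d.
  move=> /hw_cvg[K HK]; exists K => k Kk.
  have := HK (rcons w letter1 ++ nseq k letter1).
  rewrite size_cat size_nseq -(size_rcons w letter1) take_size_cat // /L eqxx.
  rewrite eqseq_rcons eqxx /= subr0 mulr1; apply.
  by rewrite (leq_trans Kk) // leq_addl.
have g0 u : (size (rcons w letter1) <= size u)%N -> gap g u = 0.
  rewrite size_rcons => wu; apply: hw_gap0; apply: contraTneq wu => ->.
  by rewrite ltnn.
have b12 : g (rcons w letter2) = - g (rcons w letter1).
  rewrite -hw_antisymmetric swap_rcons eqxx rev_letter1 swap_id //.
have gE : gap g w = 2 * g (rcons w letter1) by rewrite /gap b12; ring.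
have mE := mdrop_letter1 w hw_harmonic.
have mw : mdrop g w = 0 by rewrite /mdrop hw_eq0 // b12; ring.
rewrite mw gE in mE; rewrite gE.
have := weight_bounds digits (size w); set r := rho _ in mE * => /andP[r0 r1].
have s0 : 0 < Num.sqrt 2 ^+ size w :> R by rewrite exprn_gt0 // sqrtr_gt0.
set b := g _ in mE *.
have {}mE : mdrop g (rcons w letter1) = - (3 / 2 * (r * b)) by rewrite mE; field.
have [b0|b0] := leP b 0.
  have rb : r * b <= 0 by rewrite mulr_ge0_le0 // ltW.
  have := leftmost_bounds hw_harmonic g0 lim.
  rewrite mE -/b => /(_ _); lra.
have rb : 0 < r * b by rewrite mulr_gt0.
have rb2 : r * b <= 3 / 5 * b by rewrite ler_wpM2r // ltW.
have := leftmost_bounds_neg hw_harmonic g0 lim.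
rewrite mE -/b => /(_ _); lra.
Qed.
End Hw.
End Basis.

(** * Energy *)

Section Energy.
Variables (R : realType) (x : R) (n : nat -> nat).
Hypothesis dyad : nondyadic x.
Hypothesis digits : binary_digits x n.
Implicit Types (g : word -> R) (u v : R * R -> R) (w : word).

Local Notation rho := (weight R n).

Definition mdrop_energy g k : R :=
  (5 / 3) ^+ n k.+1 * \sum_(w : k.-tuple 'I_2) mdrop g w ^+ 2.

Definition gap_energy g k : R :=
  (5 / 3) ^+ n k.+1 * \sum_(w : k.-tuple 'I_2) gap g w ^+ 2.

Definition level_energy u m : R := (5 / 3) ^+ n m *
  \sum_(s : (n m).-tuple 'I_3 | `[< cell s `<=` Omega x >]) cell_energy u s.

Lemma level_energyE u m : level_energy u m = (5 / 3) ^+ n m *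
  \sum_(s : (n m).-tuple 'I_3 | (depth s < prefix_num n m)%N) cell_energy u s.
Proof.
congr (_ * _); apply: eq_bigl => s; apply/asboolP/idP.
  by move/(cell_OmegaP dyad digits (size_tuple s)).
by move=> ?; apply/(cell_OmegaP dyad digits (size_tuple s)).
Qed.

Lemma cell_energy_topcell u w : cell_energy u (topcell n w) =
  2 * mdrop (vertex_val n u) w ^+ 2 + 3 / 2 * gap (vertex_val n u) w ^+ 2.
Proof.
rewrite cell_energyE pt_topcell0 !(pt_topcell digits) -!/(vertex_val _ _ _).
by rewrite /mdrop /gap; field.
Qed.

Lemma level_energy0 u : level_energy u 0 = 0.
Proof. by rewrite level_energyE /= big_pred0 ?mulr0. Qed.

Lemma ratio_cancel i j : (i <= j)%N ->
  (5 / 3) ^+ j * (3 / 5) ^+ (j - i) = (5 / 3) ^+ i :> R.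
Proof.
move=> ij; rewrite -{1}(subnKC ij) exprD -mulrA -exprMn.
by rewrite (_ : 5 / 3 * (3 / 5) = 1) ?expr1n ?mulr1 //; field.
Qed.

Lemma level_energyS u m : cell_harmonic (Omega x) u ->
  level_energy u m.+1 = level_energy u m +
    (2 * mdrop_energy (vertex_val n u) m + 3 / 2 * gap_energy (vertex_val n u) m).
Proof.
move=> hu; rewrite !level_energyE (sum_depth_ltS digits) mulrDr; congr (_ + _).
  rewrite !mulr_sumr; apply: eq_bigr => s ds.
  rewrite (cell_energy_cat _ hu); last first.
    by apply/(cell_OmegaP dyad digits (size_tuple s)).
  by rewrite mulrA ratio_cancel // ltnW // (digitS digits).
rewrite /mdrop_energy /gap_energy; set A := _ ^+ _.
set S1 := \sum_w mdrop _ _ ^+ 2; set S2 := \sum_w gap _ _ ^+ 2.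
transitivity (A * (2 * S1 + 3 / 2 * S2)); last by ring.
congr (_ * _); rewrite !mulr_sumr -big_split /=.
by apply: eq_bigr => w _; exact: cell_energy_topcell.
Qed.

Lemma mdrop_energy_ge0 g k : 0 <= mdrop_energy g k.
Proof.
rewrite mulr_ge0 ?exprn_ge0 ?divr_ge0 // sumr_ge0 // => w _; exact: sqr_ge0.
Qed.

Lemma gap_energy_ge0 g k : 0 <= gap_energy g k.
Proof.
rewrite mulr_ge0 ?exprn_ge0 ?divr_ge0 // sumr_ge0 // => w _; exact: sqr_ge0.
Qed.

(** The cross terms of M and D cancel between the two siblings, and the change of scale absorbs one
    of the two factors rho. *)
Lemma mdrop_energyS g k : tree_harmonic rho g -> mdrop_energy g k.+1 =
  rho k * (mdrop_energy g k / 2 + 9 / 8 * gap_energy g k).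
Proof.
move=> hg; rewrite /mdrop_energy /gap_energy.
rewrite (sum_tuple_rcons _ (fun w => mdrop g w ^+ 2)).
transitivity (\sum_(w : k.-tuple 'I_2) (5 / 3) ^+ n k.+1 *
    (rho k * (mdrop g w ^+ 2 / 2 + 9 / 8 * gap g w ^+ 2))).
  rewrite mulr_sumr; apply: eq_bigr => w _.
  rewrite !big_ord_recl big_ord0 addr0.
  rewrite (_ : lift ord0 ord0 = letter2); last exact: val_inj.
  rewrite -/letter1 (mdrop_letter1 _ hg) (mdrop_letter2 _ hg) size_tuple.
  rewrite -(ratio_cancel (ltnW (digitS digits k.+1))) -/(weight R n k).
  by field.
by rewrite -mulr_sumr -mulr_sumr big_split /= -mulr_suml -mulr_sumr; ring.
Qed.

Lemma level_energy_le u m : cell_harmonic (Omega x) u ->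
  tree_harmonic rho (vertex_val n u) ->
  level_energy u m <= 20 / 7 * mdrop_energy (vertex_val n u) 0 +
    24 / 7 * \sum_(k < m) gap_energy (vertex_val n u) k.
Proof.
move=> hu hg; set g := vertex_val n u in hg *.
(* The added term closes the induction: 20/7 = 2 + (20/7)(3/10) and 24/7 = 3/2 + (20/7)(27/40),
   where 3/10 and 27/40 are 3/5 times 1/2 and 9/8. *)
suff : level_energy u m + 20 / 7 * mdrop_energy g m <=
    20 / 7 * mdrop_energy g 0 + 24 / 7 * \sum_(k < m) gap_energy g k.
  by have := mdrop_energy_ge0 g m; lra.
elim: m => [|m IH]; first by rewrite level_energy0 big_ord0; lra.
rewrite (level_energyS _ hu) mdrop_energyS // big_ord_recr /= -/g.
have /andP[r0 r1] := weight_bounds digits m.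
have : rho m * (mdrop_energy g m / 2 + 9 / 8 * gap_energy g m) <=
   3 / 5 * (mdrop_energy g m / 2 + 9 / 8 * gap_energy g m).
  rewrite ler_wpM2r //.
  by have := mdrop_energy_ge0 g m; have := gap_energy_ge0 g m; lra.
lra.
Qed.

(** The M-parts with positive index are dropped. The index is shifted because M_0 enters only from
    level 1 on. *)
Lemma level_energy_ge u m : cell_harmonic (Omega x) u ->
  2 * mdrop_energy (vertex_val n u) 0 +
    3 / 2 * \sum_(k < m.+1) gap_energy (vertex_val n u) k <= level_energy u m.+1.
Proof.
move=> hu; set g := vertex_val n u; elim: m => [|m IH].
  by rewrite (level_energyS _ hu) level_energy0 big_ord_recr big_ord0 /=; lra.
rewrite (level_energyS _ hu) big_ord_recr /= -/g.
by have := mdrop_energy_ge0 g m.+1; lra.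
Qed.

Lemma level_energy_mono u m : cell_harmonic (Omega x) u ->
  level_energy u m <= level_energy u m.+1.
Proof.
move=> hu; rewrite (level_energyS _ hu) lerDl.
have := mdrop_energy_ge0 (vertex_val n u) m.
by have := gap_energy_ge0 (vertex_val n u) m; lra.
Qed.

(** The flux identities used in the energy computations; being linear, they pass to finite sums of
    basis functions. *)
Definition regular u := cell_harmonic (Omega x) u /\ junction_harmonic n u.

Lemma fluxD (k : R) u v s i :
  flux (fun p => u p + k * v p) s i = flux u s i + k * flux v s i.
Proof.
by rewrite /flux mulr_sumr -big_split /=; apply: eq_bigr => j _; ring.
Qed.

Lemma regularD (k : R) u v : regular u -> regular v ->
  regular (fun p => u p + k * v p).
Proof.
move=> [cu ju] [cv jv]; split.
  move=> s sO a b ab; rewrite !fluxD.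
  by have := cu s sO a b ab; have := cv s sO a b ab; nra.
by move=> w i; rewrite !fluxD; have := ju w i; have := jv w i; nra.
Qed.

Lemma flux_cst (k : R) s i : flux (fun=> k) s i = 0.
Proof. by rewrite /flux big1 // => j _; rewrite subrr. Qed.

Lemma regular_cst (k : R) : regular (fun=> k).
Proof. by split=> [s _ a b _|w i]; rewrite !flux_cst addr0. Qed.

Lemma regular_sum u (T : Type) (r : seq T) (k : T -> R) (v : T -> R * R -> R) :
  regular u -> (forall y, regular (v y)) ->
  regular (fun p => u p + \sum_(y <- r) k y * v y p).
Proof.
move=> ru rv; elim: r => [|y r IH].
  by under eq_fun => p do rewrite big_nil addr0.
under eq_fun => p do rewrite big_cons addrCA addrC.
exact: regularD.
Qed.

(** * Truncated Haar expansions and their energy *)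

Section Extension.
Variables (a b : R) (c : word -> R) (h0 h : R * R -> R).
Variable hw : word -> R * R -> R.
Hypothesis hh0 : harmonic_with_boundary x 1 (fun=> 0) h0.
Hypothesis hhw : forall w, harmonic_with_boundary x 0 (psi x n w) (hw w).

Definition truncation m (p : R * R) : R :=
  a * h0 p + b * (1 - h0 p) +
  \sum_(k < m) \sum_(w : k.-tuple 'I_2) c w * hw w p.

Lemma regular_truncation m : regular (truncation m).
Proof.
have rH (y : R) u bd : harmonic_with_boundary x y bd u -> regular u.
  by move=> hu; split; [exact: (harmonic_cell dyad digits hu)|
    exact: (harmonic_top dyad digits hu)].
elim: m => [|m IH].
  have -> : truncation 0 = fun p => b + (a - b) * h0 p.
    by apply: funext => p; rewrite /truncation big_ord0; ring.
  by apply: regularD; [exact: regular_cst|exact: rH hh0].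
have -> : truncation m.+1 = fun p => truncation m p +
    \sum_(w : m.-tuple 'I_2) c w * hw w p.
  by apply: funext => p; rewrite /truncation big_ord_recr addrA.
by apply: regular_sum => // w; exact: rH (hhw w).
Qed.

Lemma truncation_mdrop m : mdrop (vertex_val n (truncation m)) [::] =
  (a - b) * mdrop (vertex_val n h0) [::].
Proof.
elim: m => [|m IH].
  by rewrite /mdrop /vertex_val /truncation !big_ord0; field.
rewrite -IH -[RHS]addr0.
have <- : \sum_(w : m.-tuple 'I_2) c w * mdrop (vertex_val n (hw w)) [::] = 0.
  by rewrite big1 // => w _; rewrite (hw_mdrop_nil dyad digits (hhw w)) mulr0.
under eq_bigr => w _ do rewrite /mdrop mulrBr mulrA mulrDr mulrDl.
rewrite big_split sumrN big_split /= -!mulr_suml.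
by rewrite /mdrop /vertex_val /truncation !big_ord_recr /=; ring.
Qed.

Lemma truncation_gap m (u : word) : gap (vertex_val n (truncation m)) u =
  \sum_(k < m) \sum_(w : k.-tuple 'I_2) c w * gap (vertex_val n (hw w)) u.
Proof.
have h0g := h0_gap dyad digits hh0 u.
elim: m => [|m IH].
  rewrite big_ord0 -[RHS](mulr0 (a - b)) -h0g.
  by rewrite /gap /vertex_val /truncation !big_ord0; ring.
rewrite big_ord_recr /= -IH.
under eq_bigr => w _ do rewrite /gap mulrBr.
rewrite sumrB.
by rewrite /gap /vertex_val /truncation !big_ord_recr /=; ring.
Qed.

Lemma truncation_gapE m (u : word) : (size u < m)%N ->
  gap (vertex_val n (truncation m)) u = c u * gap (vertex_val n (hw u)) u.
Proof.
move=> um; rewrite truncation_gap (bigD1 (Ordinal um)) //=.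
rewrite (bigD1 (in_tuple u)) //= big1 => [|w wu]; last first.
  by rewrite (hw_gap0 dyad digits (hhw w)) ?mulr0 // eq_sym.
rewrite addr0 big1 ?addr0 // => k ku; rewrite big1 // => w _.
rewrite (hw_gap0 dyad digits (hhw w)) ?mulr0 //.
apply: contraNneq ku => uw; apply/eqP; apply: val_inj => /=.
by rewrite uw size_tuple.
Qed.

Definition qlevel k : R :=
  \sum_(w : k.-tuple 'I_2) 2 ^+ k * (5 / 3) ^+ n k.+1 * `|c w| ^+ 2.

Lemma truncation_gap_energy m k : (k < m)%N ->
  49 / 64 * qlevel k <= gap_energy (vertex_val n (truncation m)) k <= 4 * qlevel k.
Proof.
move=> km; rewrite /qlevel /gap_energy !mulr_sumr.
have p0 : 0 <= (5 / 3 : R) ^+ n k.+1 by rewrite exprn_ge0 // divr_ge0.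
(* The squares of the constants 7/8 and 2 of [hw_gap]. *)
have H (w : k.-tuple 'I_2) : 49 / 64 * (2 ^+ k * `|c w| ^+ 2) <=
    gap (vertex_val n (truncation m)) w ^+ 2 <= 4 * (2 ^+ k * `|c w| ^+ 2).
  rewrite truncation_gapE ?size_tuple // exprMn real_normK ?num_real //.
  have := hw_gap dyad digits (hhw w); rewrite size_tuple.
  set t := gap _ _; have -> : 2 ^+ k = (Num.sqrt 2 ^+ k) ^+ 2 :> R.
    by rewrite exprAC sqr_sqrtr.
  have : 0 <= Num.sqrt 2 ^+ k :> R by rewrite exprn_ge0 // sqrtr_ge0.
  set s := _ ^+ k => s0 /andP[t1 t2].
  have c0 := sqr_ge0 (c w).
  have T1 : 49 / 64 * s ^+ 2 <= t ^+ 2 by nra.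
  have T2 : t ^+ 2 <= 4 * s ^+ 2 by nra.
  by apply/andP; split; nra.
apply/andP; split; apply: ler_sum => w _; have /andP[h1 h2] := H w.
  by apply: le_trans (ler_wpM2l p0 h1); rewrite le_eqVlt; apply/orP; left;
    apply/eqP; ring.
by apply: le_trans (ler_wpM2l p0 h2) _; rewrite le_eqVlt; apply/orP; left;
    apply/eqP; ring.
Qed.

Lemma qlevel_ge0 k : 0 <= qlevel k.
Proof. by apply: sumr_ge0 => w _; rewrite !mulr_ge0 ?exprn_ge0 ?divr_ge0. Qed.

Definition qpartial m : R :=
  (5 / 3) ^+ n 1%N * (a - b) ^+ 2 + \sum_(k < m) qlevel k.

Lemma truncation_mdrop_energy m :
  49 / 100 * ((5 / 3) ^+ n 1%N * (a - b) ^+ 2) <=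
    mdrop_energy (vertex_val n (truncation m)) 0 <=
  (5 / 3) ^+ n 1%N * (a - b) ^+ 2.
Proof.
rewrite /mdrop_energy.
rewrite (sum_tuple0 (fun w => mdrop (vertex_val n (truncation m)) w ^+ 2)).
rewrite truncation_mdrop [(_ * mdrop _ _) ^+ 2]exprMn.
have p0 : 0 <= (5 / 3 : R) ^+ n 1%N by rewrite exprn_ge0 // divr_ge0.
have := h0_mdrop dyad digits hh0; set d := mdrop _ _ => /andP[d1 d2].
have D1 : 49 / 100 <= d ^+ 2 by nra.
have D2 : d ^+ 2 <= 1 by nra.
have A0 : 0 <= (5 / 3) ^+ n 1%N * (a - b) ^+ 2 by rewrite mulr_ge0 ?sqr_ge0.
rewrite [X in _ <= X <= _]mulrA; set A := _ ^+ n 1%N * _ in A0 *.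
by rewrite ler_piMr // andbT mulrC ler_wpM2l.
Qed.

(** Below, 2 * 49/100 = 49/50 and (3/2)(49/64) > 49/50; above, 20/7 < 14 and (24/7) * 4 = 96/7 <
    14. *)
Lemma truncation_energy m :
  49 / 50 * qpartial m.+1 <= level_energy (truncation m.+1) m.+1 <=
  14 * qpartial m.+1.
Proof.
have [ct jt] := regular_truncation m.+1.
have hg := vertex_val_harmonic dyad digits ct jt.
have := level_energy_le m.+1 ct hg; have := level_energy_ge m ct.
have /andP[M1 M2] := truncation_mdrop_energy m.+1.
have G1 : 49 / 64 * \sum_(k < m.+1) qlevel k <=
    \sum_(k < m.+1) gap_energy (vertex_val n (truncation m.+1)) k.
  rewrite mulr_sumr; apply: ler_sum => k _.
  by case/andP: (truncation_gap_energy (ltn_ord k)).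
have G2 : \sum_(k < m.+1) gap_energy (vertex_val n (truncation m.+1)) k <=
    4 * \sum_(k < m.+1) qlevel k.
  rewrite mulr_sumr; apply: ler_sum => k _.
  by case/andP: (truncation_gap_energy (ltn_ord k)).
have Q0 : 0 <= \sum_(k < m.+1) qlevel k 
  by apply: sumr_ge0 => k _; exact: qlevel_ge0.
have A0 : 0 <= (5 / 3) ^+ n 1%N * (a - b) ^+ 2.
  by rewrite mulr_ge0 ?sqr_ge0 // exprn_ge0 // divr_ge0.
rewrite /qpartial; lra.
Qed.

(** The cell lies in some T_u with |u| < m <= |w|. The corners of T_u belong to words of length at
    most |w|, where h_w is 0, and a function harmonic on a cell vanishes with its corner values. *)
Lemma hw_vanish m s i w : size s = n m -> (depth s < prefix_num n m)%N ->
  (m <= size w)%N -> hw w (pt s i) = 0.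
Proof.
move=> sm ds mw; have [u [v [um ->]]] := depth_lt_prefix digits sm ds.
apply: (cell_harmonic0 (harmonic_cell dyad digits (hhw w))).
  exact: (@topcell_Omega _ _ _ dyad digits).
have um' : (size u < size w)%N by exact: leq_trans mw.
move=> j; case: (unliftP ord0 j) => [l|] ->.
  rewrite (pt_topcell digits); apply: (hw_eq0 dyad digits (hhw w)).
  by rewrite size_rcons.
by rewrite pt_topcell0; apply: (hw_eq0 dyad digits (hhw w)); exact: ltnW.
Qed.

Hypothesis hE : {in Omega x, h =1 haar_extension a b c h0 hw}.

Lemma extension_truncation m m' s i : size s = n m ->
  (depth s < prefix_num n m)%N -> (m <= m')%N ->
  h (pt s i) = truncation m' (pt s i).
Proof.
move=> sm ds mm'; rewrite hE; last first.
  apply/mem_set; move/(cell_OmegaP dyad digits sm): ds; apply.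
  exact: cell_pt.
rewrite /haar_extension /truncation; congr (_ + _).
have E k : (m <= k)%N -> series (fun k => \sum_(w : k.-tuple 'I_2)
    c w * hw w (pt s i)) k =
    series (fun k => \sum_(w : k.-tuple 'I_2) c w * hw w (pt s i)) m.
  move=> /subnKC <-; elim: (k - m)%N => [|d IH]; first by rewrite addn0.
  rewrite addnS seriesSr IH big1 ?addr0 // => w _.
  by rewrite (hw_vanish _ sm ds) ?mulr0 // size_tuple leq_addr.
transitivity (series (fun k => \sum_(w : k.-tuple 'I_2) c w * hw w (pt s i)) m').
  rewrite (E _ mm'); apply: lim_near_cst => //; near=> k; apply: E; near: k.
  exact: nbhs_infty_ge.
by rewrite seriesEord.
Unshelve. all: by end_near. Qed.

Lemma extension_energy m m' : (m <= m')%N ->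
  level_energy h m = level_energy (truncation m') m.
Proof.
move=> mm'; rewrite !level_energyE; congr (_ * _); apply: eq_bigr => s ds.
rewrite /cell_energy; apply: eq_bigr => i _; apply: eq_bigr => j _.
by rewrite !(extension_truncation _ (size_tuple s) ds mm').
Qed.

End Extension.
End Energy.

Theorem corollary2p5 (R : realType) :
  exists C1 C2 : R, 0 < C1 /\ 0 < C2 /\
  forall (x : R) (n : nat -> nat)
    (mu : probability (measurableTypeR R * measurableTypeR R)%type R)
    (h0 : R * R -> R) (hw : word -> R * R -> R)
    (a b : R) (f : R * R -> R) (c : word -> R) (h : R * R -> R),
  0 < x < 1 -> nondyadic x -> binary_digits x n ->
  cantor_measure x n mu ->
  harmonic_with_boundary x 1 (fun=> 0) h0 ->
  (forall w : word, harmonic_with_boundary x 0 (psi x n w) (hw w)) ->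
  square_integrable x mu f ->
  b = haar_mean x mu f ->
  (forall w : word, c w = haar_coef x n mu f w) ->
  {in Omega x, h =1 haar_extension a b c h0 hw} ->
  ((C1%:E * Qform n a b c <= energy x n h)%E /\
   (energy x n h <= C2%:E * Qform n a b c)%E) /\
  ((energy x n h < +oo)%E <-> (Qform n a b c < +oo)%E).
Proof.
exists (49 / 50), 14; split; first by rewrite divr_gt0.
split=> // x n mu h0 hw a b f c h _ dyad digits _ hh0 hhw _ _ _ hE.
have lvlE := extension_energy dyad digits hhw hE.
(* Stated from level 1 on: at level 0 the energy is 0, whereas [qpartial] already contains the term
   in (a - b)^2. *)
have bound m : 49 / 50 * qpartial n a b c m.+1 <= level_energy x n h m.+1 <=
    14 * qpartial n a b c m.+1.
  by rewrite (lvlE _ m.+1) //; exact: truncation_energy.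
have mono m : level_energy x n h m <= level_energy x n h m.+1.
  rewrite (lvlE m m.+1) // (lvlE m.+1 m.+1) //.
  apply: level_energy_mono => //.
  by have [] := regular_truncation dyad digits a b c hh0 hhw m.+1.
have Ecvg : cvgn (fun m => (level_energy x n h m)%:E).
  apply: ereal_nondecreasing_is_cvgn; apply/nondecreasing_seqP => m.
  by rewrite lee_fin.
have Qcvg : (fun m => (qpartial n a b c m)%:E) @ \oo --> Qform n a b c.
  rewrite /Qform; have -> : (fun m => (qpartial n a b c m)%:E) =
      (fun m => (((5 / 3) ^+ n 1%N * (a - b) ^+ 2)%:E +
         \sum_(0 <= k < m) (qlevel n c k)%:E)%E).
    by apply: funext => m; rewrite sumEFin big_mkord.
  apply: cvgeD; [exact: fin_num_adde_defr|exact: cvg_cst|].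
  apply: is_cvg_nneseries => k _ _; rewrite lee_fin; exact: qlevel_ge0.
have lower : ((49 / 50)%:E * Qform n a b c <= energy x n h)%E.
  apply: (lee_cvg_to (cvgeZl _ Qcvg) Ecvg) => //; near=> m.
  have /prednK <- : (0 < m)%N by near: m; exact: nbhs_infty_gt.
  by rewrite -EFinM lee_fin; case/andP: (bound m.-1).
have upper : (energy x n h <= 14%:E * Qform n a b c)%E.
  apply: (lee_cvg_to Ecvg (cvgeZl _ Qcvg)) => //; near=> m.
  have /prednK <- : (0 < m)%N by near: m; exact: nbhs_infty_gt.
  by rewrite -EFinM lee_fin; case/andP: (bound m.-1).
do 2 split=> //; last by move=> Qy; apply: le_lt_trans upper _;
  exact: lte_mul_pinfty.
move=> Ey; rewrite ltey; apply/eqP => Qy.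
by move: (le_lt_trans lower Ey); rewrite Qy gt0_muley // lte_fin divr_gt0.
Unshelve. all: by end_near. Qed.
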